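(* Let $(H_N)_{N=8n^3,\ n=1,2,\dots}$ be the sequence of quasi-cubic configurations on $S^3$ (defined in the context), with effective masses $M_{\mathrm{eff}}(H_N)$ and total masses $M_{\mathrm{tot}}(H_N)$. Then, as $N\to\infty$, $$\frac{\left|M_{\mathrm{eff}}(H_N)-M_{\mathrm{tot}}(H_N)\right|}{M_{\mathrm{tot}}(H_N)}=O(N^{-1/3}),$$ so that the relative mass deficit of $H_N$ tends to $0$.
   Context: $S^3\subset\mathbf{R}^4$ is the unit round 3-sphere, $\Lambda(\cdot,\cdot)$ its geodesic distance and $\mathrm{vol}$ its volume measure (total volume $2\pi^2$). A configuration is a non-empty finite set of pairs $(x_i,\alpha_i)$, $i=1,\dots,N$, of distinct points $x_i\in S^3$ (punctures) and real numbers $\alpha_i>0$ (mass parameters), with $\alpha=\sum_i\alpha_i$. Its conformal factor is $\Phi(x)=\sum_{n=1}^N\frac{\alpha_n}{\sin(\Lambda(x,x_n)/2)}$ with mean $\langle\Phi\rangle=\frac{1}{2\pi^2}\int_{S^3}\Phi\,d\mathrm{vol}$. The effective mass is $M_{\mathrm{eff}}=\frac{3\pi}{4}\langle\Phi\rangle^2$ (which equals $\frac{64}{3\pi}\alpha^2$), and the total mass is $M_{\mathrm{tot}}=\sum_{n=1}^N\sum_{m\ne n}\frac{4\alpha_m\alpha_n}{\sin(\Lambda(x_m,x_n)/2)}$. Construction of $H_N$, $N=8n^3$. Let $r_1,\dots,r_8$ be the points $(\pm1,0,0,0),(0,\pm1,0,0),(0,0,\pm1,0),(0,0,0,\pm1)$,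 and let $\Sigma_k=\{x\in S^3:\Lambda(x,r_k)\le\Lambda(x,r_i)\text{ for all }i\ne k\}$ be their Voronoi cells (''big quasi-cubes''). On the cell around $(1,0,0,0)$ use the central projection $\psi(x_1,x_2,x_3,x_4)=(x_2/x_1,x_3/x_1,x_4/x_1)$, which maps the cell bijectively onto the cube $[-1,1]^3\subset\mathbf{R}^3$; on the other seven cells use the analogous projection (dividing the other three coordinates by the coordinate along which $r_k$ is nonzero). Divide $[-1,1]^3$ into $n^3$ congruent axis-parallel cubes of side $2/n$, and pull these back by the projection to obtain $n^3$ small quasi-cubes in each $\Sigma_k$, hence a partition of $S^3$ into $N=8n^3$ domains $P_i$. The puncture $x_i\in P_i$ is the preimage of the center of the corresponding small cube, and its mass parameter is $\alpha_i=\frac{\alpha}{2\pi^2}\mathrm{vol}(P_i)$, with $\alpha>0$ arbitrary. $H_N$ is the resulting configuration $\{(x_i,\alpha_i)\}_{i=1}^N$. The constant implied by $O(\cdot)$ does not depend on $N$ (nor on the choice of $\alpha$). *)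

(* Defs.v *)
From HB Require Import structures.
From mathcomp Require Import all_boot all_order all_algebra.
From mathcomp Require Import all_classical all_reals all_analysis.
From mathcomp Require Import measurable_realfun.
From mathcomp Require Import lra.

Set Implicit Arguments.
Unset Strict Implicit.
Unset Printing Implicit Defensive.
Import Order.TTheory GRing.Theory Num.Theory.
Import numFieldNormedType.Exports.
Local Open Scope classical_set_scope.
Local Open Scope ring_scope.

Section Sphere.
Context {R : realType}.
Implicit Types (x y : 4.-tuple R) (A : set (4.-tuple R)).

Definition dot x y : R := \sum_(i < 4) tnth x i * tnth y i.

Definition enorm x : R := Num.sqrt (dot x x).

Definition S3 : set (4.-tuple R) := [set x | enorm x = 1].

Definition geodist x y : R := acos (dot x y).

Definition tuple_of_prod
  (p : measurableTypeR R * measurableTypeR R * measurableTypeR R *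
       measurableTypeR R) : 4.-tuple R :=
  [tuple p.1.1.1; p.1.1.2; p.1.2; p.2].

Definition lebesgue4 A : \bar R :=
  (lebesgue_measure \x lebesgue_measure \x lebesgue_measure
     \x lebesgue_measure)%E (tuple_of_prod @^-1` A).

Definition radial_projection x : 4.-tuple R := [tuple of map (fun t => t / enorm x) x].

Definition radial_cone A : set (4.-tuple R) :=
  [set y | 0 < enorm y <= 1 /\ A (radial_projection y)].

(* The volume measure of the unit round 3-sphere in polar coordinates: as
   Lebesgue measure on R^4 is r^3 dr dvol, the set of points of the punctured
   unit ball whose radial projection lies in A has Lebesgue measure
   vol(A) / 4. *)
Definition vol A : \bar R :=
  (4%:E * lebesgue4 (radial_cone A))%E.

Lemma measurable_tuple_of_prod : measurable_fun setT tuple_of_prod.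
Proof.
apply/measurable_fun_tnthP => i.
case: i => [[|[|[|[|//]]]] ?] /=.
- apply: (measurableT_comp measurable_fst).
  exact: (measurableT_comp measurable_fst measurable_fst).
- apply: (measurableT_comp measurable_snd).
  exact: (measurableT_comp measurable_fst measurable_fst).
- exact: (measurableT_comp measurable_snd measurable_fst).
- exact: measurable_snd.
Qed.

Lemma measurable_enorm : measurable_fun setT enorm.
Proof.
apply: (@measurableT_comp _ _ _ _ _ _ (@Num.sqrt R)).
  apply: continuous_measurable_fun; exact: sqrt_continuous.
apply: measurable_sum => i.
by apply: measurable_funM; exact: measurable_tnth.
Qed.

Lemma measurable_radial_projection : measurable_fun setT radial_projection.
Proof.
apply/measurable_fun_tnthP => i.
rewrite (_ : _ \o _ = fun x => tnth x i * (enorm x) `^ (-1)); last first.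
  by apply/funext => x /=; rewrite tnth_map powR_inv1// sqrtr_ge0.
apply: measurable_funM; first exact: measurable_tnth.
apply: (@measurableT_comp _ _ _ _ _ _ (@powR R ^~ (-1)) _ enorm).
  exact: measurable_powR.
exact: measurable_enorm.
Qed.

Let measurable_radial_cone A : measurable A -> measurable (tuple_of_prod @^-1` radial_cone A).
Proof.
move=> mA; rewrite -[_ @^-1` _]setTI.
apply: measurable_tuple_of_prod => //.
rewrite (_ : radial_cone A = enorm @^-1` `]0, 1] `&` radial_projection @^-1` A).
  apply: measurableI; rewrite -[X in measurable X]setTI.
    exact: measurable_enorm.
  exact: measurable_radial_projection.
by apply/seteqP; split => y /=; rewrite in_itv.
Qed.

Let vol0 : vol set0 = 0%E.
Proof.
rewrite /vol /lebesgue4 (_ : _ @^-1` _ = set0) ?measure0 ?mule0//.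
by apply/seteqP; split => // y [].
Qed.

Let vol_ge0 A : (0 <= vol A)%E.
Proof. by rewrite mule_ge0// measure_ge0. Qed.

Let vol_semi_sigma_additive : semi_sigma_additive vol.
Proof.
move=> F mF tF mUF.
rewrite [X in X @ _](_ : _ = fun n => (4%:E * \sum_(0 <= i < n)
    lebesgue4 (radial_cone (F i)))%E); last first.
  by apply/funext => n; rewrite ge0_sume_distrr// => i _; exact: measure_ge0.
apply: cvgeZl => //.
rewrite /lebesgue4.
rewrite (_ : _ @^-1` _ = \bigcup_i tuple_of_prod @^-1` radial_cone (F i)); last first.
  apply/seteqP; split => y /=; first by move=> [? [i _ Fi]]; exists i.
  by move=> [i _ [? Fi]]; split => //; exists i.
apply: measure_semi_sigma_additive => //.
- by move=> i; exact: measurable_radial_cone.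
- apply/trivIsetP => i j _ _ ij; apply/seteqP; split => // y [[_ Fi] [_ Fj]].
  by move/trivIsetP : tF => /(_ i j I I ij)/seteqP[+ _]; apply; split; [exact: Fi|exact: Fj].
- by apply: bigcupT_measurable => i; exact: measurable_radial_cone.
Qed.

HB.instance Definition _ := isMeasure.Build _ _ _ vol
  vol0 vol_ge0 vol_semi_sigma_additive.

End Sphere.

Section Configuration.
Context {R : realType}.

(* Only the data: that the sites are non-empty, the punctures distinct points of
   S3 and the masses positive is not imposed. *)
Record configuration := Configuration {
  site : finType ;
  puncture : site -> 4.-tuple R ;
  mass : site -> R }.

Implicit Type H : configuration.

(* At a puncture the term below is 0 instead of infinity, as division by zero
   yields zero; this is immaterial for the mean. *)
Definition conformal_factor H (x : 4.-tuple R) : R :=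
  \sum_(i : site H) mass i / sin (geodist x (puncture i) / 2).

Definition sphere_mean (f : 4.-tuple R -> R) : R :=
  (2 * pi ^+ 2)^-1 * \int[vol]_(x in S3) f x.

Definition effective_mass H : R :=
  3 * pi / 4 * sphere_mean (conformal_factor H) ^+ 2.

Definition total_mass H : R :=
  \sum_(i : site H) \sum_(j : site H | j != i)
    4 * mass j * mass i / sin (geodist (puncture j) (puncture i) / 2).

Definition relative_deficit H : R :=
  `|effective_mass H - total_mass H| / total_mass H.

End Configuration.
Arguments configuration : clear implicits.

Section QuasiCubic.
Context {R : realType}.

(* Big quasi-cubes are indexed by a coordinate axis of R^4 and a sign, true
   being the negative one. *)
Definition face : finType := ('I_4 * bool)%type.

Definition face_center (k : face) : 4.-tuple R :=
  [tuple if i == k.1 then (-1) ^+ k.2 else 0 | i < 4].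

Definition big_quasi_cube (k : face) : set (4.-tuple R) :=
  [set x | S3 x /\ forall k', k' != k ->
     geodist x (face_center k) <= geodist x (face_center k')].

Definition central_projection (k : face) (x : 4.-tuple R) : 3.-tuple R :=
  [tuple tnth x (lift k.1 j) / tnth x k.1 | j < 3].

Definition small_cube n (c : {ffun 'I_3 -> 'I_n}) : set (3.-tuple R) :=
  [set u | forall j, -1 + 2 / n%:R * (c j)%:R <= tnth u j
                       <= -1 + 2 / n%:R * (c j).+1%:R].

Definition cube_center n (c : {ffun 'I_3 -> 'I_n}) : 3.-tuple R :=
  [tuple -1 + 2 / n%:R * ((c j)%:R + 1 / 2) | j < 3].

Definition small_index n : finType := (face * {ffun 'I_3 -> 'I_n})%type.

Definition small_quasi_cube n (i : small_index n) : set (4.-tuple R) :=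
  [set x | big_quasi_cube i.1 x /\ small_cube i.2 (central_projection i.1 x)].

Definition center_preimage n (i : small_index n) : set (4.-tuple R) :=
  [set x | big_quasi_cube i.1 x /\ central_projection i.1 x = cube_center i.2].

Lemma S3P (x : 4.-tuple R) : S3 x <-> dot x x = 1.
Proof.
have d0 : 0 <= dot x x by rewrite sumr_ge0// => i _; rewrite -expr2 sqr_ge0.
rewrite /S3 /enorm /=; split => [x1|->]; last exact: sqrtr1.
by rewrite -[LHS]sqr_sqrtr// x1 expr1n.
Qed.

Lemma dot_face_center (x : 4.-tuple R) (k : face) :
  dot x (face_center k) = (-1) ^+ k.2 * tnth x k.1.
Proof.
rewrite /dot (bigD1 k.1)//= big1 ?addr0; last first.
  by move=> i ik; rewrite tnth_mktuple (negbTE ik) mulr0.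
by rewrite tnth_mktuple eqxx mulrC.
Qed.

Lemma big_quasi_cubeP (k : face) (x : 4.-tuple R) : S3 x ->
  big_quasi_cube k x <-> forall i, `|tnth x i| <= (-1) ^+ k.2 * tnth x k.1.
Proof.
move=> Sx.
have xb i (b : bool) : (-1) ^+ b * tnth x i \in `[-1, 1].
  rewrite in_itv/= -ler_norml normrM normrX normrN1 expr1n mul1r.
  rewrite -(@ler_sqr R) ?nnegrE// expr1n real_normK ?num_real//.
  move/S3P : Sx => <-; rewrite /dot (bigD1 i)//= -expr2 lerDl sumr_ge0// => j _.
  by rewrite -expr2 sqr_ge0.
have ge (k1 k2 : face) : (geodist x (face_center k1) <= geodist x (face_center k2)) =
    ((-1) ^+ k2.2 * tnth x k2.1 <= (-1) ^+ k1.2 * tnth x k1.1).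
  rewrite /geodist !dot_face_center.
  move: (xb k1.1 k1.2) (xb k2.1 k2.2); move: (_ * _) (_ * _) => a b.
  move=> a1 b1; rewrite -[in RHS](acosK a1) -[in RHS](acosK b1).
  rewrite !leNgt ltr_cos// in_itv/=; move: a1 b1; rewrite !in_itv/= => a1 b1;
    by rewrite ?acos_ge0 ?acos_lepi.
split=> [[_ H] i|H].
  have {}H (b : bool) : (-1) ^+ b * tnth x i <= (-1) ^+ k.2 * tnth x k.1.
    have [<-//|ik] := eqVneq (i, b) k.
    by have := H (i, b) ik; rewrite ge.
  have := H true; have := H false; rewrite expr0 expr1 ler_norml.
  by move=> ? ?; apply/andP; split; lra.
split=> // k' _; rewrite ge; apply: le_trans (H k'.1).
by rewrite (le_trans (ler_norm _))// normrM normrX normrN1 expr1n mul1r.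
Qed.

Lemma center_preimageE n (i : small_index n) :
  exists x : 4.-tuple R, center_preimage i = [set x].
Proof.
case: i => -[a b] c; pose u j : R := tnth (cube_center c) j.
pose s : R := (-1) ^+ b; have ss : s * s = 1 by rewrite -expr2 sqrr_sign.
have u1 j : `|u j| <= 1.
  have n0 : (0 < n)%N by case: (n) (c j) => // -[].
  have cn : (c j)%:R + 1 <= n%:R :> R by rewrite natr1 ler_nat.
  have c0 : 0 <= (c j)%:R :> R by rewrite ler0n.
  have n0' : 0 < n%:R :> R by rewrite ltr0n.
  rewrite /u tnth_mktuple ler_norml; set t := _ * _.
  have t0 : 0 <= t by rewrite mulr_ge0 ?divr_ge0//; lra.
  have t2 : t <= 2 by rewrite /t mulrAC ler_pdivrMr//; lra.
  by apply/andP; split; lra.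
pose w2 : R := 1 + \sum_(j < 3) u j ^+ 2.
have w20 : 0 < w2.
  by rewrite ltr_pwDl// sumr_ge0// => j _; rewrite sqr_ge0.
pose w := Num.sqrt w2.
have w0 : 0 < w by rewrite sqrtr_gt0.
have ww : w * w = w2 by rewrite -expr2 sqr_sqrtr// ltW.
have dotE (x : 4.-tuple R) : dot x x =
    tnth x a ^+ 2 + \sum_(j < 3) tnth x (lift a j) ^+ 2.
  rewrite /dot (bigD1_ord a)//= -expr2; congr (_ + _).
exists [tuple s / w * (if unlift a i is Some j then u j else 1) | i < 4].
set x := [tuple _ | _ < _].
have xa : tnth x a = s / w by rewrite tnth_mktuple unlift_none mulr1.
have xj j : tnth x (lift a j) = s / w * u j by rewrite tnth_mktuple liftK.
have sw0 : s / w != 0.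
  by rewrite mulf_neq0 ?signr_eq0// invr_eq0 gt_eqF.
have Sx : S3 x.
  apply/S3P; rewrite dotE xa.
  under eq_bigr do rewrite xj exprMn.
  rewrite -mulr_sumr -[X in X + _]mulr1 -mulrDr -/w2 -ww.
  by rewrite expr_div_n sqrr_sign -expr2 mul1r mulVf// expf_neq0// gt_eqF.
apply/seteqP; split => y /=.
  move=> [By py]; have Sy := By.1.
  have {}By := (big_quasi_cubeP (a, b) Sy).1 By.
  have yj j : tnth y (lift a j) = u j * tnth y a.
    have [ya0|ya0] := eqVneq (tnth y a) 0.
      by have := By (lift a j); rewrite /= ya0 !mulr0 normr_le0 => /eqP.
    have := congr1 (fun t => tnth t j) py.
    by rewrite /central_projection /= tnth_mktuple /u => <-; rewrite divfK.
  have ya : tnth y a = s / w.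
    have : dot y y = 1 by apply/S3P.
    rewrite dotE; under eq_bigr do rewrite yj exprMn.
    rewrite -mulr_suml -[X in X + _]mul1r -mulrDl -/w2 -ww -expr2 -exprMn.
    move=> e; have sy : 0 <= s * tnth y a by rewrite (le_trans _ (By a)).
    have : (s * (tnth y a * w)) ^+ 2 = 1.
      by rewrite exprMn sqrr_sign mul1r [_ * w]mulrC.
    move/eqP; rewrite sqrp_eq1; last by rewrite mulrA mulr_ge0// ltW.
    move=> /eqP e1; rewrite -[s]mulr1 -e1 mulrA ss mul1r mulfK// gt_eqF//.
  apply: eq_from_tnth => i; case: (unliftP a i) => [j|] ->.
    by rewrite yj xj ya mulrC.
  by rewrite ya xa.
move=> ->; split.
  apply/(big_quasi_cubeP (a, b) Sx) => i /=.
  rewrite xa -/s mulrA ss mul1r /x tnth_mktuple normrM normf_div normrX normrN1 expr1n.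
  rewrite div1r (gtr0_norm w0); apply: ler_piMr; first by rewrite invr_ge0 ltW.
  by case: unliftP => [j|] _; rewrite ?normr1.
apply: eq_from_tnth => j; rewrite /central_projection /= tnth_mktuple xj xa.
by rewrite mulrAC divff// mul1r.
Qed.

Definition quasi_cubic (n : nat) (alpha : R) : configuration R :=
  @Configuration R (small_index n)
    (fun i => get (center_preimage i))
    (fun i => alpha / (2 * pi ^+ 2) * fine (vol (small_quasi_cube i))).

End QuasiCubic.

(* Main.v *)
(* With chord = 2 sin(geodist/2), the kernel 1/sin(geodist/2) is 2/chord, and by
   rotation invariance its integral c0 = 32 pi/3 over the sphere does not depend
   on the pole. As the masses are proportional to the cell volumes v_i, the mean
   of the conformal factor is exact: with V = 2 pi^2, M_eff = 4 (alpha/V)^2 V c0,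
   while M_tot = 4 (alpha/V)^2 S with S the sum over i <> j of
   v_i v_j 2/chord(x_i, x_j). For fixed i the inner sum is a Riemann sum of c0:
   cells have diameter at most 4/n and stay at distance at least 1/(4n) from the
   punctures of other cells, so on a cell the error is at most a multiple of
   1/n times the integral of (2/chord)^2. That square is integrable on a
   3-dimensional sphere, so |S - V c0| = O(1/n) = O(N^(-1/3)).

   Volumes on the sphere are volumes of cones in R^4. Zonal integrals
   follow from invariance under plane rotations (products of shears) and from
   integrating out two coordinates in polar form. *)

From HB Require Import structures.
Require Import Defs.
From mathcomp Require Import all_boot all_order all_algebra.
From mathcomp Require Import all_classical all_reals all_analysis.
From mathcomp Require Import ring lra measurable_realfun.

Import Order.TTheory GRing.Theory Num.Theory.
Import numFieldNormedType.Exports.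
Local Open Scope classical_set_scope.
Local Open Scope ring_scope.

Set Implicit Arguments.
Unset Strict Implicit.
Unset Printing Implicit Defensive.

(** * Affine changes of variables and plane rotations *)

(** The kernel is not Lipschitz near its pole, so small cells alone do not control the Riemann sum.
    What the separation buys is comparability: the distances A, B from the pole to two points of
    another cell satisfy B <= 17 A, since the diameter 4/n is 16 times the separation 1/(4n). Then
    |2/A - 2/B| = 2 |B - A| / (A B) is at most (34/n) (2/B)^2, with B the distance to the variable
    point. The pole's own cell has no term in M_tot, but its share of the integral obeys the same
    bound, so one integral of the squared kernel covers all errors. That integral is at most 32 pi =
    3 c0, which gives the relative error 3 * 34 / n = 102 / n against V c0. Dividing by S >= V c0 /
    2 doubles it to 204 / n, and N^(-1/3) = 1 / (2n) turns 204 into 408. The squared radius is used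
    as radial variable: planar polar coordinates then have the constant density pi. Half-turns are
    not among the rotations obtained from shears; this leaves a sign on the axis, removed by
    reflecting a one-dimensional integral. *)

Section Lebesgue.
Context {R : realType}.
Local Notation T := (measurableTypeR R).
Local Notation mu := (@lebesgue_measure R).
Local Open Scope ereal_scope.
Implicit Types f : T -> \bar R.

Let measurable_affine (a b : R) : measurable_fun [set: T] (fun x : T => (a * x + b)%R : T).
Proof.
by apply: measurable_funD => //; apply: measurable_funM.
Qed.

Let affine_preimage (a b : R) (c d : R) : (0 < a)%R ->
  (fun x : R => a * x + b)%R @^-1` `]c, d] = `]((c - b) / a)%R, ((d - b) / a)%R]%classic.
Proof.
move=> a0; apply/seteqP; split => x /=; rewrite !in_itv/= ltr_pdivrMr// ler_pdivlMr//;
  by move=> /andP[? ?]; apply/andP; split; lra.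
Qed.

(** By uniqueness, Lebesgue measure is [a] times its image under the affine map, since the two agree
    on half-open intervals. *)
Lemma ge0_integral_affine (a b : R) f : (0 < a)%R -> measurable_fun setT f ->
  (forall x, 0 <= f x) -> a%:E * \int[mu]_x f (a * x + b)%R = \int[mu]_x f x.
Proof.
move=> a0 mf f0.
pose g : {mfun T >-> T} := HB.pack (fun x : T => (a * x + b)%R : T)
  (isMeasurableFun.Build _ _ _ _ _ (measurable_affine a b)).
have muE A : measurable A -> mu A = mscale (NngNum (ltW a0)) (pushforward mu g) A.
  apply: lebesgue_measure_unique => _ [[c d]] _ <-.
  rewrite [RHS](_ : _ = a%:E * mu `]((c - b) / a)%R, ((d - b) / a)%R]); last first.
    by congr (_ * mu _); exact: affine_preimage.
  rewrite /= !lebesgue_measure_itv/= !lte_fin.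
  rewrite ltr_pM2r ?invr_gt0// ltrD2r; case: ifPn => cd; last by rewrite mule0.
  rewrite -!EFinD -EFinM; congr (_%:E); field; exact: lt0r_neq0.
rewrite [RHS](_ : _ = \int[mscale (NngNum (ltW a0)) (pushforward mu g)]_x f x).
  rewrite ge0_integral_mscale//=; congr (_ * _).
  by rewrite ge0_integral_pushforward.
by apply: eq_measure_integral => A mA _; exact: muE.
Qed.

Lemma ge0_integral_translation (b : R) f : measurable_fun setT f ->
  (forall x, 0 <= f x) -> \int[mu]_x f (x + b)%R = \int[mu]_x f x.
Proof.
move=> mf f0; rewrite -[RHS](@ge0_integral_affine 1%R b)// mul1e.
by under [RHS]eq_integral do rewrite mul1r.
Qed.

Lemma ge0_integral_opp f : measurable_fun setT f ->
  (forall x, 0 <= f x) -> \int[mu]_x f (- x)%R = \int[mu]_x f x.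
Proof.
move=> mf f0.
rewrite [LHS](_ : _ = \int[mu]_(x in (-%R : T -> T) @^-1` setT) (f \o -%R) x)//.
rewrite -(@ge0_integral_pushforward _ _ _ _ _ (-%R : T -> T))//.
apply: eq_measure_integral => A mA _; have := lebesgue_measureN mA; exact.
Qed.

Implicit Type G : T * T -> \bar R.

Lemma ge0_integral_shear1 (a : R) G : measurable_fun setT G -> (forall p, 0 <= G p) ->
  \int[mu]_x \int[mu]_y G ((x + a * y)%R, y) = \int[mu]_x \int[mu]_y G (x, y).
Proof.
move=> mG G0.
have mG' : measurable_fun setT (fun p : T * T => G ((p.1 + a * p.2)%R, p.2)).
  apply: (measurableT_comp mG); apply: measurable_fun_pair => //=.
  by apply: measurable_funD => //; apply: measurable_funM.
apply: etrans (fubini_tonelli _ mG' (fun=> G0 _)) _.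
apply: etrans (esym (fubini_tonelli _ mG G0)).
apply: eq_integral => y _ /=.
apply: (@ge0_integral_translation (a * y) (fun x => G (x, y))) => //.
by apply: (measurableT_comp mG).
Qed.

Lemma ge0_integral_shear2 (a : R) G : measurable_fun setT G -> (forall p, 0 <= G p) ->
  \int[mu]_x \int[mu]_y G (x, (y + a * x)%R) = \int[mu]_x \int[mu]_y G (x, y).
Proof.
move=> mG G0; apply: eq_integral => x _ /=.
apply: (@ge0_integral_translation (a * x) (fun y => G (x, y))) => //.
by apply: (measurableT_comp mG).
Qed.

(* A rotation that is not a half-turn is a product of three shears. *)
Lemma ge0_integral_rotation (c s : R) G : (c ^+ 2 + s ^+ 2 = 1)%R -> s != 0%R ->
  measurable_fun setT G -> (forall p, 0 <= G p) ->
  \int[mu]_x \int[mu]_y G ((c * x - s * y)%R, (s * x + c * y)%R) =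
  \int[mu]_x \int[mu]_y G (x, y).
Proof.
(* For [c] = cos u and [s] = sin u this is - tan (u / 2), the slope of the two outer shears; the
   middle one has slope [s]. *)
move=> cs s0 mG G0; pose a : R := ((c - 1) / s)%R.
have as1 : (1 + a * s = c)%R by rewrite /a; field.
have aE : (a + a * c = - s)%R.
  have : ((c - 1) * (c + 1) = c ^+ 2 + s ^+ 2 - 1 - s ^+ 2)%R by ring.
  rewrite cs subrr sub0r.
  move=> e; transitivity ((c - 1) * (c + 1) / s)%R; first by rewrite /a; field.
  by rewrite e; field.
have mS1 : measurable_fun setT (fun p : T * T => ((p.1 + a * p.2)%R : T, p.2)).
  by apply: measurable_fun_pair => //=; apply: measurable_funD => //; apply: measurable_funM.
have mS2 : measurable_fun setT (fun p : T * T => (p.1, (p.2 + s * p.1)%R : T)).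
  by apply: measurable_fun_pair => //=; apply: measurable_funD => //; apply: measurable_funM.
have mG2 := measurableT_comp mG mS1.
apply: etrans (ge0_integral_shear1 a mG G0).
apply: etrans (ge0_integral_shear2 s mG2 (fun=> G0 _)).
apply: etrans (ge0_integral_shear1 a (measurableT_comp mG2 mS2) (fun=> G0 _)).
apply: eq_integral => x _; apply: eq_integral => y _; congr (G (_, _)) => /=; last first.
  by rewrite -as1; ring.
transitivity ((1 + a * s) * x + (a + a * (1 + a * s)) * y)%R; last by ring.
by rewrite as1 aE; ring.
Qed.

End Lebesgue.

(** * The area of the disc *)

Section HalfDisc.
Context {R : realType}.
Local Notation mu := (@lebesgue_measure R).

Lemma sqrt_1Bsqr_eq0 (t : R) : t \notin `[-1, 1] -> Num.sqrt (1 - t ^+ 2) = 0.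
Proof.
move=> t1; apply/eqP; rewrite sqrtr_eq0 subr_le0; apply: contraR t1.
rewrite -ltNge => t1; rewrite in_itv/= -ler_norml.
by rewrite -(@ler_sqr R) ?nnegrE// expr1n real_normK ?num_real// ltW.
Qed.

(** Roots of negative numbers are 0, so the weight cuts off the line by itself. Zonal integrals can
    thus be stated over the whole line and evaluated on an interval. *)
Lemma ge0_integral_1Bsqr (g : R -> \bar R) :
  (\int[mu]_t (g t * (Num.sqrt (1 - t ^+ 2)%R)%:E) =
   \int[mu]_(t in `[(-1)%R, 1%R]) (g t * (Num.sqrt (1 - t ^+ 2)%R)%:E))%E.
Proof.
rewrite [RHS]integral_mkcond; apply: eq_integral => t _.
rewrite patchE; case: ifPn => // t1; rewrite sqrt_1Bsqr_eq0 ?mule0//.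
by apply: contraNN t1 => t1; rewrite inE.
Qed.

Lemma integral_cos2 :
  (\int[mu]_(x in `[(- (pi / 2))%R, (pi / 2)%R]) (cos x * cos x)%R%:E = (pi / 2)%R%:E :> \bar R)%E.
Proof.
have pi0 : 0 < pi :> R := pi_gt0 R.
pose F (x : R) := (x + sin x * cos x) / 2.
have dF (x : R) : is_derive x 1 F (cos x * cos x).
  apply: is_derive_eq; rewrite /GRing.scale/=; have := cos2Dsin2 x.
  rewrite !expr2 => e; rewrite !(mulr0, addr0,mulr1, mul1r); lra.
have cF : continuous F.
  by move=> x; apply: differentiable_continuous; apply/derivable1_diffP; exact: ex_derive.
rewrite (@continuous_FTC2 _ _ F).
- rewrite /F !(sinN, cosN) sin_pihalf cos_pihalf -EFinB; congr (_%:E); lra.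
- lra.
- apply: continuous_subspaceT => x; apply: continuousM; exact: continuous_cos.
- split=> [x _||]; first exact: ex_derive.
  + by apply: cvg_at_right_filter; exact: cF.
  + by apply: cvg_at_left_filter; exact: cF.
- by move=> x _; rewrite derive1E; apply: derive_val.
Qed.

(** Substitute t = sin x; the cosine is nonnegative on the range of x, so the root becomes cos x. *)
Lemma integral_sqrt_1Bsqr :
  (\int[mu]_t (Num.sqrt (1 - t ^+ 2)%R)%:E = (pi / 2)%R%:E :> \bar R)%E.
Proof.
have pi0 : 0 < pi :> R := pi_gt0 R.
have := ge0_integral_1Bsqr (cst 1%E).
under eq_integral do rewrite mul1e.
under [RHS]eq_integral do rewrite mul1e.
move=> ->; rewrite -integral_cos2.
have := @integration_by_substitution_increasing R sin
  (fun t => Num.sqrt (1 - t ^+ 2)) (- (pi / 2)) (pi / 2).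
have dsin : derive1 (@sin R) = cos.
  by apply/funext => x; rewrite derive1E; apply: derive_val.
rewrite sinN sin_pihalf => ->.
- apply: eq_integral => x; rewrite inE/= in_itv/= => xpi.
  rewrite fctE/= dsin -cos2sin2 sqrtr_sqr ger0_norm//.
  exact: cos_ge0_pihalf.
- lra.
- by move=> x y xpi ypi; rewrite ltr_sin.
- by rewrite dsin => x _; exact: continuous_cos.
- rewrite dsin; apply/cvg_ex; exists (cos (- (pi / 2))).
  by apply: cvg_at_right_filter; exact: continuous_cos.
- rewrite dsin; apply/cvg_ex; exists (cos (pi / 2)).
  by apply: cvg_at_left_filter; exact: continuous_cos.
- split=> [x _||]; first exact: ex_derive.
  + by apply: cvg_at_right_filter; exact: continuous_sin.
  + by apply: cvg_at_left_filter; exact: continuous_sin.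
- apply: continuous_subspaceT => x.
  apply: (@continuous_comp _ _ _ (fun t : R => 1 - t ^+ 2)); last exact: sqrt_continuous.
  by apply: cvgB; [exact: cvg_cst|exact: exprn_continuous].
Qed.
End HalfDisc.

(** * Scaling of half-discs and polar coordinates in the plane *)

Section Disc.
Context {R : realType}.
Local Notation T := (measurableTypeR R).
Local Notation mu := (@lebesgue_measure R).
Local Notation pushforward_measure :=
  measure_function_pushforward__canonical__measure_function_Measure.
Local Open Scope ereal_scope.

Lemma measurable_sqrt_Bsqr (p : R) : measurable_fun [set: T] (fun x : T => Num.sqrt (p - x ^+ 2)%R).
Proof.
apply: continuous_measurable_fun => x.
apply: (@continuous_comp _ _ _ (fun t : R => p - t ^+ 2)%R); last exact: sqrt_continuous.
by apply: cvgB; [exact: cvg_cst|exact: exprn_continuous].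
Qed.

(** Substitute x = t sqrt p: one factor sqrt p comes from dx, the other from the root. *)
Lemma ge0_integral_halfdisc_scale (p : R) (g : T -> \bar R) : (0 < p)%R ->
  measurable_fun setT g -> (forall t, 0 <= g t) ->
  \int[mu]_x (g (x / Num.sqrt p)%R * (Num.sqrt (p - x ^+ 2)%R)%:E) =
  p%:E * \int[mu]_t (g t * (Num.sqrt (1 - t ^+ 2)%R)%:E).
Proof.
move=> p0 mg g0; have sp0 : (0 < Num.sqrt p)%R by rewrite sqrtr_gt0.
have mdiv : measurable_fun setT (fun x : T => (x / Num.sqrt p)%R : T).
  by apply: measurable_funM.
have mh : measurable_fun setT (fun x : T => g (x / Num.sqrt p)%R * (Num.sqrt (p - x ^+ 2)%R)%:E).
  apply: emeasurable_funM; first exact: (measurableT_comp mg mdiv).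
  by apply/measurable_EFinP; exact: measurable_sqrt_Bsqr.
have h0 (x : T) : 0 <= g (x / Num.sqrt p)%R * (Num.sqrt (p - x ^+ 2)%R)%:E.
  by rewrite mule_ge0// lee_fin sqrtr_ge0.
have mg1 : measurable_fun setT (fun t : T => g t * (Num.sqrt (1 - t ^+ 2)%R)%:E).
  apply: emeasurable_funM => //.
  by apply/measurable_EFinP; exact: measurable_sqrt_Bsqr.
rewrite -(ge0_integral_affine 0%R sp0 mh h0).
under eq_integral => x _.
  rewrite addr0 [(Num.sqrt p * x)%R]mulrC mulfK ?gt_eqF// exprMn sqr_sqrtr ?ltW//.
  rewrite (_ : (p - x ^+ 2 * p = p * (1 - x ^+ 2))%R); last by ring.
  rewrite sqrtrM ?ltW// EFinM muleCA.
  over.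
rewrite ge0_integralZl//; last by move=> t _; rewrite mule_ge0// lee_fin sqrtr_ge0.
by rewrite muleA -EFinM -expr2 sqr_sqrtr ?ltW.
Qed.

Lemma integral_sqrt_Bsqr (p : R) :
  \int[mu]_x (Num.sqrt (p - x ^+ 2)%R)%:E = (pi / 2 * Num.max p 0)%R%:E.
Proof.
have [p0|p0] := leP p 0%R.
  rewrite mulr0 integral0_eq// => x _; congr (_%:E); apply/eqP; rewrite sqrtr_eq0.
  by rewrite subr_le0 (le_trans p0)// sqr_ge0.
have := @ge0_integral_halfdisc_scale p (cst 1) p0 (measurable_cst _) (fun=> lee01).
under eq_integral do rewrite mul1e.
move=> ->; under eq_integral do rewrite mul1e.
by rewrite integral_sqrt_1Bsqr -EFinM mulrC.
Qed.

Lemma lebesgue_measure_sqr_le (e : R) :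
  mu [set y : T | (y ^+ 2 <= e)%R] = (2 * Num.sqrt e)%R%:E.
Proof.
have [e0|e0] := ltP e 0%R.
  rewrite ltr0_sqrtr// mulr0 (_ : [set _ | _] = set0) ?measure0//.
  apply/seteqP; split => // y /= /le_lt_trans /(_ e0).
  by rewrite ltNge sqr_ge0.
rewrite (_ : [set _ | _] = `[(- Num.sqrt e)%R, Num.sqrt e]%classic).
  rewrite lebesgue_measure_itv/= lte_fin; case: ifPn => [_|].
    by rewrite -EFinD; congr (_%:E); ring.
  rewrite -leNgt => h; congr (_%:E).
  by have := sqrtr_ge0 e; lra.
have ye (y : R) : (y ^+ 2 <= e)%R = (`|y| <= Num.sqrt e)%R.
  by rewrite -[RHS](@ler_sqr R) ?nnegrE ?sqrtr_ge0// sqr_sqrtr// real_normK ?num_real.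
by apply/seteqP; split => y; rewrite /= in_itv/= -ler_norml ye.
Qed.

Let h (p : T * T) : T := (p.1 ^+ 2 + p.2 ^+ 2)%R.

Let mh : measurable_fun setT h.
Proof. by apply: measurable_funD; apply: measurable_funX. Qed.

Let disc_area (d : R) : (mu \x mu) (h @^-1` `]-oo, d]) = (pi * Num.max d 0)%R%:E.
Proof.
rewrite /product_measure1 /=.
transitivity (\int[mu]_x (2 * Num.sqrt (d - x ^+ 2))%R%:E).
  apply: eq_integral => x _ /=; rewrite -lebesgue_measure_sqr_le; congr (mu _).
  apply/seteqP; split => y; rewrite /xsection/= inE /h/= in_itv/= => ?; lra.
under eq_integral do rewrite EFinM.
have mE : measurable_fun setT (fun x : T => (Num.sqrt (d - x ^+ 2))%R%:E).
  by apply/measurable_EFinP; exact: measurable_sqrt_Bsqr.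
rewrite ge0_integralZl//.
by rewrite integral_sqrt_Bsqr -EFinM; congr (_%:E); lra.
Qed.

Let push_itv (c d : R) : (c <= d)%R ->
  (mu \x mu) (h @^-1` `]c, d]) = (pi * (Num.max d 0 - Num.max c 0))%R%:E.
Proof.
move=> cd.
have mS (e : R) : measurable (h @^-1` `]-oo, e]).
  by rewrite -[X in measurable X]setTI; exact: mh.
have -> : h @^-1` `]c, d] = h @^-1` `]-oo, d] `\` h @^-1` `]-oo, c].
  apply/seteqP; split => p /=; rewrite !in_itv/=.
    by move=> /andP[cp ->]; split => //; apply/negP; rewrite -ltNge.
  by move=> [-> /negP]; rewrite -ltNge => ->.
have fin : (mu \x mu) (h @^-1` `]-oo, d]) < +oo by rewrite disc_area ltry.
rewrite measureD//.
rewrite setIidr; last first.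
  by move=> p /=; rewrite !in_itv/= => /le_trans; apply.
rewrite mulrBr EFinB; congr (_ - _); exact: disc_area.
Qed.

Let push_measure (A : set T) : measurable A -> A `<=` `[0%R, +oo[ ->
  (mu \x mu) (h @^-1` A) = pi%:E * mu A.
Proof.
move=> mA A0; have pi0 : (0 < pi :> R)%R := pi_gt0 R.
have ipi0 : (0 <= (pi : R)^-1)%R by rewrite invr_ge0 ltW.
have mN : measurable (`]-oo, 0%R[%classic : set T) by [].
(* Uniqueness characterises Lebesgue measure on the whole line, while the image of the squared
   radius lives on the half-line. Lebesgue measure on the negative numbers is added to fill the
   gap. *)
pose nu := measure_add (mscale (NngNum ipi0) (pushforward_measure (mu \x mu) mh)) (mrestr mu mN).
have nuE B : nu B = (pi^-1)%:E * (mu \x mu) (h @^-1` B) + mu (B `&` `]-oo, 0%R[%classic).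
  by rewrite /nu measure_addE.
have : mu A = nu A.
  apply: lebesgue_measure_unique => // _ [[c d]] _ <-.
  apply: etrans (esym (nuE _)) => /=.
  have [dc|cd] := leP d c.
    rewrite set_itv_ge ?bnd_simp -?leNgt//.
    by rewrite preimage_set0 set0I !measure0 mule0 adde0.
  rewrite lebesgue_measure_itv/= lte_fin cd push_itv ?ltW// -EFinM mulKf ?gt_eqF//.
  have [d0|d0] := ltP d 0%R.
    rewrite setIidl; last by move=> x /=; rewrite !in_itv/= => /andP[_ /le_lt_trans]; exact.
    rewrite lebesgue_measure_itv/= lte_fin cd max_r ?ltW//; last lra.
    by rewrite subrr add0e.
  have [c0|c0] := ltP c 0%R.
    rewrite (_ : _ `&` _ = `]c, 0%R[%classic).
      rewrite lebesgue_measure_itv/= lte_fin c0 -!EFinD subr0 sub0r.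
      by congr (_%:E); lra.
    apply/seteqP; split => x /=; rewrite !in_itv/=.
      by move=> [/andP[-> _] ->].
    by move=> /andP[-> x0]; split => //=; lra.
  rewrite (_ : _ `&` _ = set0) ?measure0 ?adde0//.
  by apply/seteqP; split => x //=; rewrite !in_itv/= => -[/andP[cx _] x0]; lra.
rewrite nuE (_ : A `&` _ = set0) ?measure0 ?adde0.
  by move=> ->; rewrite muleA -EFinM divff ?gt_eqF// mul1e.
apply/seteqP; split => x //= [/A0/=]; rewrite !in_itv/= andbT => x0 x1; lra.
Qed.

(** The disc of squared radius q has area pi q, so the squared radius carries plane measure to pi dq
    on the half-line. *)
Lemma ge0_integral_polar (phi : T -> \bar R) : measurable_fun setT phi ->
  (forall q, 0 <= phi q) ->
  \int[mu]_x \int[mu]_y phi (x ^+ 2 + y ^+ 2)%R = pi%:E * \int[mu]_(q in `[0%R, +oo[) phi q.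
Proof.
move=> mphi phi0; have pi0 : (0 < pi :> R)%R := pi_gt0 R.
apply: etrans (esym (@fubini_tonelli1 _ _ _ _ _ mu mu (phi \o h) (measurableT_comp mphi mh) (fun=> phi0 _))) _.
transitivity (\int[pushforward_measure (mu \x mu) mh]_(q in `[0%R, +oo[) phi q).
  rewrite ge0_integral_pushforward//; last exact: measurable_funTS.
  congr (integral _ _ _); apply/seteqP; split => // p _ /=; rewrite in_itv/= andbT.
  by rewrite addr_ge0// sqr_ge0.
rewrite -(@ge0_integral_mscale _ _ _ _ _ _ (NngNum (ltW pi0)))//; last exact: measurable_funTS.
by apply: eq_measure_integral => A mA AS; have := push_measure mA AS; exact.
Qed.

End Disc.

(** * Rotation invariance on R^4 *)

(* The sigma-finite structure that unification finds on [m1 \x m2] is the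
   library's one for subprobabilities, hence an explicit general one. *)
Definition sigma_finite_prod d1 d2 (T1 : measurableType d1) (T2 : measurableType d2)
    (R : realType) (m1 : {sigma_finite_measure set T1 -> \bar R})
    (m2 : {sigma_finite_measure set T2 -> \bar R}) :
    {sigma_finite_measure set (T1 * T2)%type -> \bar R} :=
  HB.pack (m1 \x m2)%E
    (Measure_isSigmaFinite.Build _ _ _ (m1 \x m2)%E
       (lebesgue_integral_fubini.product_measure_sigma_finite_subproof m1 m2)).

Section Tonelli.
Context {R : realType}.
Local Notation T := (measurableTypeR R).
Local Notation mu := (@lebesgue_measure R).
Local Open Scope ereal_scope.

Lemma ge0_integral_prod2 d (X : measurableType d)
    (m : {sigma_finite_measure set X -> \bar R}) (f : X * T * T -> \bar R) :
  measurable_fun setT f -> (forall p, 0 <= f p) ->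
  \int[m \x mu \x mu]_p f p = \int[m]_x \int[mu]_y \int[mu]_z f ((x, y), z).
Proof.
move=> mf f0.
apply: etrans (@fubini_tonelli1 _ _ _ _ _ (sigma_finite_prod m mu) mu f mf f0) _.
apply: (@fubini_tonelli1 _ _ _ _ _ m mu (fubini_F mu f)).
  exact: (measurable_fun_fubini_tonelli_F (m2 := mu)).
by move=> p; apply: integral_ge0.
Qed.

(** The untouched factor is an arbitrary sigma-finite space, so that the same lemma serves for
    coordinates 3, 4 of R^4 and, once the last one is integrated out, for coordinates 2, 3. *)
Lemma ge0_integral_rotation_prod2 d (X : measurableType d)
    (m : {sigma_finite_measure set X -> \bar R}) (c s : R) (f : X * T * T -> \bar R) :
  (c ^+ 2 + s ^+ 2 = 1)%R -> s != 0%R ->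
  measurable_fun setT f -> (forall p, 0 <= f p) ->
  \int[m \x mu \x mu]_p
    f ((p.1.1, (c * p.1.2 - s * p.2)%R), (s * p.1.2 + c * p.2)%R) =
  \int[m \x mu \x mu]_p f p.
Proof.
move=> cs s0 mf f0.
have mrot : measurable_fun setT (fun p : X * T * T =>
    ((p.1.1, (c * p.1.2 - s * p.2)%R : T), (s * p.1.2 + c * p.2)%R : T)).
  have m1 : measurable_fun setT (fun p : X * T * T => p.1.1).
    exact: measurableT_comp measurable_fst measurable_fst.
  have m2 : measurable_fun setT (fun p : X * T * T => p.1.2).
    exact: measurableT_comp measurable_snd measurable_fst.
  apply: measurable_fun_pair; first apply: measurable_fun_pair => //.
    by apply: measurable_funB; apply: measurable_funM.
  by apply: measurable_funD; apply: measurable_funM.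
apply: etrans (@ge0_integral_prod2 _ _ m _ (measurableT_comp mf mrot) (fun=> f0 _)) _.
apply: etrans (esym (@ge0_integral_prod2 _ _ m _ mf f0)).
apply: eq_integral => x _ /=.
apply: (ge0_integral_rotation (G := fun p => f ((x, p.1), p.2)) cs s0) => //.
apply: (measurableT_comp mf); apply: measurable_fun_pair => //.
by apply: measurable_fun_pair.
Qed.

Local Notation m4 := (mu \x mu \x mu \x mu)%E.

Definition sqnorm4 (p : T * T * T * T) : T :=
  (p.1.1.1 ^+ 2 + p.1.1.2 ^+ 2 + p.1.2 ^+ 2 + p.2 ^+ 2)%R.

Lemma measurable_sqnorm4 : measurable_fun setT sqnorm4.
Proof.
by repeat apply: measurable_funD; apply: measurable_funX => //;
  do ?[exact: measurableT_comp measurable_fst measurable_fst |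
   exact: measurableT_comp measurable_snd measurable_fst];
  [exact: measurableT_comp measurable_fst (measurableT_comp measurable_fst measurable_fst)
  |exact: measurableT_comp measurable_snd (measurableT_comp measurable_fst measurable_fst)].
Qed.

Definition linear4 (a b c d : R) (p : T * T * T * T) : T :=
  (a * p.1.1.1 + b * p.1.1.2 + c * p.1.2 + d * p.2)%R.

Lemma measurable_linear4 a b c d : measurable_fun setT (linear4 a b c d).
Proof.
by repeat apply: measurable_funD; apply: measurable_funM => //;
  do ?[exact: measurableT_comp measurable_fst measurable_fst |
   exact: measurableT_comp measurable_snd measurable_fst];
  [exact: measurableT_comp measurable_fst (measurableT_comp measurable_fst measurable_fst)
  |exact: measurableT_comp measurable_snd (measurableT_comp measurable_fst measurable_fst)].
Qed.

Variables (k : T * T -> \bar R).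
Hypotheses (mk : measurable_fun setT k) (k0 : forall p, 0 <= k p).

(** The integrand sees a point only through a linear form and the norm. A rotation keeps the norm,
    so it acts on the four coefficients alone. *)
Let J a b c d := \int[m4]_p k (linear4 a b c d p, sqnorm4 p).

Let mJ a b c d : measurable_fun setT (fun p => k (linear4 a b c d p, sqnorm4 p)).
Proof.
apply: (measurableT_comp mk); apply: measurable_fun_pair.
  exact: measurable_linear4.
exact: measurable_sqnorm4.
Qed.

Let hyp (c d : R) : d != 0%R -> exists r : R,
  [/\ (0 < r)%R, (r ^+ 2 = c ^+ 2 + d ^+ 2)%R, ((c / r) ^+ 2 + (d / r) ^+ 2 = 1)%R & (d / r != 0)%R].
Proof.
move=> d0; have cd : (0 < c ^+ 2 + d ^+ 2)%R by rewrite ltr_wpDl ?sqr_ge0// exprn_even_gt0.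
exists (Num.sqrt (c ^+ 2 + d ^+ 2)); rewrite sqrtr_gt0 cd; split=> //.
- by rewrite sqr_sqrtr// ltW.
- by rewrite !expr_div_n -mulrDl sqr_sqrtr ?ltW// divff ?gt_eqF.
- by rewrite mulf_neq0// invr_eq0 gt_eqF// sqrtr_gt0.
Qed.

(** Rotating by the angle of (c, d) aligns this part of the form with one axis. When [d] is 0
    nothing is rotated and r = c keeps its sign, so only the square of [r] is controlled. *)
Let J34 a b c d : exists r, (r ^+ 2 = c ^+ 2 + d ^+ 2)%R /\ J a b c d = J a b r 0.
Proof.
have [->|d0] := eqVneq d 0%R; first by exists c; rewrite expr0n/= addr0.
have [r [r0 rE cs s0]] := hyp c d0; exists r; split => //.
apply: etrans (esym (@ge0_integral_rotation_prod2 _ _ (sigma_finite_prod mu mu) _ _ _ cs s0 (mJ a b c d) (fun=> k0 _))) _.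
apply: eq_integral => p _; congr (k (_, _)).
  rewrite /linear4/=.
  transitivity (a * p.1.1.1 + b * p.1.1.2 + (c ^+ 2 + d ^+ 2) / r * p.1.2)%R; first by field; exact: lt0r_neq0.
  by rewrite -rE; field; exact: lt0r_neq0.
rewrite /sqnorm4/=.
transitivity (p.1.1.1 ^+ 2 + p.1.1.2 ^+ 2 + ((c / r) ^+ 2 + (d / r) ^+ 2) * (p.1.2 ^+ 2 + p.2 ^+ 2))%R; first by ring.
by rewrite cs; ring.
Qed.

Let J23 a b c : exists r, (r ^+ 2 = b ^+ 2 + c ^+ 2)%R /\ J a b c 0 = J a r 0 0.
Proof.
have [->|d0] := eqVneq c 0%R; first by exists b; rewrite expr0n/= addr0.
have [r [r0 rE cs s0]] := hyp b d0; exists r; split => //.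
apply: etrans (@fubini_tonelli1 _ _ _ _ _ (sigma_finite_prod (sigma_finite_prod mu mu) mu) mu _ (mJ a b c 0) (fun=> k0 _)) _.
apply: etrans (esym (@fubini_tonelli1 _ _ _ _ _ (sigma_finite_prod (sigma_finite_prod mu mu) mu) mu _ (mJ a r 0 0) (fun=> k0 _))).
have mF := measurable_fun_fubini_tonelli_F (m2 := mu) _ (mJ a b c 0) (fun=> k0 _).
apply: etrans (esym (@ge0_integral_rotation_prod2 _ _ mu _ _ _ cs s0 mF _)) _.
  by move=> p; apply: integral_ge0 => *; exact: k0.
apply: eq_integral => p _; apply: eq_integral => w _; congr (k (_, _)).
  rewrite /linear4/=.
  transitivity (a * p.1.1 + (b ^+ 2 + c ^+ 2) / r * p.1.2)%R; first by field; exact: lt0r_neq0.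
  by rewrite -rE; field; exact: lt0r_neq0.
rewrite /sqnorm4/=.
transitivity (p.1.1 ^+ 2 + ((b / r) ^+ 2 + (c / r) ^+ 2) * (p.1.2 ^+ 2 + p.2 ^+ 2) + w ^+ 2)%R; first by ring.
by rewrite cs; ring.
Qed.

Let J12 a b : exists r, (r ^+ 2 = a ^+ 2 + b ^+ 2)%R /\ J a b 0 0 = J r 0 0 0.
Proof.
have [->|d0] := eqVneq b 0%R; first by exists a; rewrite expr0n/= addr0.
have [r [r0 rE cs s0]] := hyp a d0; exists r; split => //.
apply: etrans (@ge0_integral_prod2 _ _ (sigma_finite_prod mu mu) _ (mJ a b 0 0) (fun=> k0 _)) _.
apply: etrans (esym (@ge0_integral_prod2 _ _ (sigma_finite_prod mu mu) _ (mJ r 0 0 0) (fun=> k0 _))).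
have F1 a' b' (p : T * T * T) : 0 <= \int[mu]_z k (linear4 a' b' 0 0 (p, z), sqnorm4 (p, z)).
  by apply: integral_ge0 => z _.
have mF a' b' := measurable_fun_fubini_tonelli_F (m2 := mu) _
  (measurable_fun_fubini_tonelli_F (m2 := mu) _ (mJ a' b' 0 0) (fun=> k0 _))
  (F1 a' b').
have F0 a' b' (q : T * T) : 0 <= \int[mu]_y \int[mu]_z
   k (linear4 a' b' 0 0 ((q, y), z), sqnorm4 ((q, y), z)).
  by apply: integral_ge0 => y _; apply: integral_ge0 => z _.
apply: etrans (@fubini_tonelli1 _ _ _ _ _ mu mu _ (mF a b) (F0 a b)) _.
apply: etrans (esym (@fubini_tonelli1 _ _ _ _ _ mu mu _ (mF r 0%R) (F0 r 0%R))).
apply: etrans (esym (ge0_integral_rotation cs s0 (mF a b) (F0 a b))) _.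
apply: eq_integral => x _; apply: eq_integral => y _.
apply: eq_integral => z _; apply: eq_integral => w _; congr (k (_, _)).
  rewrite /linear4/=.
  transitivity ((a ^+ 2 + b ^+ 2) / r * x)%R; first by field; exact: lt0r_neq0.
  by rewrite -rE; field; exact: lt0r_neq0.
rewrite /sqnorm4/=.
transitivity (((a / r) ^+ 2 + (b / r) ^+ 2) * (x ^+ 2 + y ^+ 2) + z ^+ 2 + w ^+ 2)%R; first by ring.
by rewrite cs; ring.
Qed.

(** Three plane rotations push all coefficients onto the first coordinate. The one that remains has
    square 1, whence the undetermined sign. *)
Lemma ge0_integral_linear4_rotation (a b c d : R) :
  (a ^+ 2 + b ^+ 2 + c ^+ 2 + d ^+ 2 = 1)%R ->
  exists e : bool, \int[m4]_p k (linear4 a b c d p, sqnorm4 p) =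
    \int[m4]_p k ((-1) ^+ e * p.1.1.1, sqnorm4 p)%R.
Proof.
move=> abcd.
have [r1 [r1E JE1]] := J34 a b c d; have [r2 [r2E JE2]] := J23 a b r1.
have [r3 [r3E JE3]] := J12 a r2.
have : (r3 ^+ 2 = 1)%R by rewrite r3E r2E r1E !addrA.
move/eqP; rewrite sqrf_eq1 => r3e.
exists (r3 != 1%R).
have -> : ((-1) ^+ (r3 != 1) = r3)%R.
  by have [->//|r31] := eqVneq r3 1%R; move: r3e; rewrite (negbTE r31) => /eqP ->.
apply: etrans JE1 _; apply: etrans JE2 _; apply: etrans JE3 _.
by apply: eq_integral => p _; congr (k (_, _)); rewrite /linear4 !mul0r !addr0.
Qed.

End Tonelli.

(** * Axial functions on R^4 and zonal functions on the punctured unit ball *)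

Section Axial.
Context {R : realType}.
Local Notation T := (measurableTypeR R).
Local Notation mu := (@lebesgue_measure R).
Local Open Scope ereal_scope.
Local Notation m4 := (mu \x mu \x mu \x mu)%E.

Let A : set (T * T * T) := [set w | (w.1.1 ^+ 2 + w.1.2 ^+ 2 <= w.2)%R].

Let mA : measurable A.
Proof.
rewrite (_ : A = (fun w : T * T * T => (w.1.1 ^+ 2 + w.1.2 ^+ 2 - w.2)%R) @^-1` `]-oo, 0%R]).
  rewrite -[X in measurable X]setTI.
  have m : measurable_fun setT (fun w : T * T * T => (w.1.1 ^+ 2 + w.1.2 ^+ 2 - w.2)%R : T).
    apply: measurable_funB => //; apply: measurable_funD; apply: measurable_funX.
      exact: measurableT_comp measurable_fst measurable_fst.
    exact: measurableT_comp measurable_snd measurable_fst.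
  exact: m.
by apply/seteqP; split => w; rewrite /A/= in_itv/= subr_le0.
Qed.

(** Polar coordinates in the last two variables bring in their squared radius r >= 0. Taking p = x^2
    + y^2 + r as variable instead turns r >= 0 into the region [A], and the remaining y-integral is
    the length of an interval. *)
Lemma ge0_integral_axial4 (k : T * T -> \bar R) :
  measurable_fun setT k -> (forall p, 0 <= k p) ->
  \int[m4]_p k (p.1.1.1, sqnorm4 p) =
  pi%:E * \int[mu]_x \int[mu]_p (k (x, p) * (2 * Num.sqrt (p - x ^+ 2))%R%:E).
Proof.
move=> mk k0; have pi0 : (0 < pi :> R)%R := pi_gt0 R.
pose W (w : T * T * T) := k (w.1.1, w.2) * (\1_A w)%:E.
have W0 w : 0 <= W w by rewrite mule_ge0// lee_fin.
have mW : measurable_fun setT W.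
  apply: emeasurable_funM.
    apply: (measurableT_comp mk); apply: measurable_fun_pair => //.
    exact: measurableT_comp measurable_fst measurable_fst.
  by apply/measurable_EFinP; exact: measurable_indic.
have mk4 : measurable_fun setT (fun p : T * T * T * T => k (p.1.1.1, sqnorm4 p)).
  apply: (measurableT_comp mk); apply: measurable_fun_pair.
    exact: measurableT_comp measurable_fst (measurableT_comp measurable_fst measurable_fst).
  exact: measurable_sqnorm4.
apply: etrans (@ge0_integral_prod2 _ _ _ (sigma_finite_prod mu mu) _ mk4 (fun=> k0 _)) _.
transitivity (\int[sigma_finite_prod mu mu]_q (pi%:E * \int[mu]_p W (q, p))).
  apply: eq_integral => q _.
  have mphi : measurable_fun setT (fun r : T => k (q.1, (q.1 ^+ 2 + q.2 ^+ 2 + r)%R)).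
    apply: (measurableT_comp mk); apply: measurable_fun_pair => //.
    exact: measurable_funD.
  have := ge0_integral_polar mphi (fun=> k0 _).
  under eq_integral do under eq_integral do rewrite addrA.
  move=> ->; congr (_ * _).
  have mWq : measurable_fun setT (fun p => W (q, p)).
    by apply: (measurableT_comp mW); exact: measurable_fun_pair.
  (* The shift from r to the full squared norm p. *)
  rewrite -(ge0_integral_translation (q.1 ^+ 2 + q.2 ^+ 2)%R mWq (fun=> W0 _)).
  rewrite integral_mkcond; apply: eq_integral => r _.
  rewrite /W/= patchE indicE /A [(r + _)%R]addrC.
  have [r0|r0] := leP 0%R r.
    by rewrite !mem_set ?mule1//= ?in_itv/= ?andbT ?lerDl.
  rewrite !memNset ?mule0//=; first by apply/negP; rewrite -ltNge gtrDl.
  by rewrite in_itv/= andbT; apply/negP; rewrite -ltNge.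
have mF : measurable_fun setT (fun q : T * T => \int[mu]_p W (q, p)).
  exact: (@measurable_fun_fubini_tonelli_F _ _ _ _ _ mu W mW W0).
have F0 (q : T * T) : 0 <= \int[mu]_p W (q, p) by apply: integral_ge0.
rewrite ge0_integralZl//; last by rewrite lee_fin ltW.
congr (_ * _).
apply: etrans (@fubini_tonelli1 _ _ _ _ _ mu mu _ mF F0) _.
apply: eq_integral => x _.
have mWx : measurable_fun setT (fun q : T * T => W ((x, q.1), q.2)).
  apply: (measurableT_comp mW); apply: measurable_fun_pair => //.
  by apply: measurable_fun_pair.
(* After exchanging y and p only the indicator of y^2 <= p - x^2 depends on y. *)
apply: etrans (@fubini_tonelli _ _ _ _ _ mu mu _ mWx (fun=> W0 _)) _.
apply: eq_integral => p _; rewrite /W/=.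
have mAx : measurable [set y : T | (y ^+ 2 <= p - x ^+ 2)%R].
  rewrite (_ : [set _ | _] = (fun y : T => (y ^+ 2)%R : T) @^-1` `]-oo, (p - x ^+ 2)%R]).
    rewrite -[X in measurable X]setTI.
    have m : measurable_fun setT (fun y : T => (y ^+ 2)%R : T) by exact: measurable_funX.
    exact: m.
  by apply/seteqP; split => w; rewrite /= in_itv/=.
rewrite -lebesgue_measure_sqr_le.
set B := [set y : T | _].
transitivity (k (x, p) * \int[mu]_y (\1_B y)%:E); last by rewrite integral_indic// setIT.
have mB : measurable_fun [set: T] (fun y : T => (\1_B y)%:E : \bar R).
  by apply/measurable_EFinP; exact: measurable_indic.
rewrite -[RHS]ge0_integralZl//; try by move=> y _; rewrite lee_fin.
apply: eq_integral => y _; rewrite !indicE /A /B; congr (_ * (nat_of_bool _)%:R%:E).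
by apply/idP/idP; rewrite !inE/= => ?; lra.
Qed.

Let integral_2p : \int[mu]_(p in `]0%R, 1%R]) (2 * p)%R%:E = 1 :> \bar R.
Proof.
have m2p : measurable_fun (`]0%R, 1%R]%classic : set T) (fun p : T => (2 * p)%R%:E).
  by apply/measurable_EFinP; apply: measurable_funM.
apply: etrans (integral_itv_obnd_cbnd m2p) _.
rewrite (@continuous_FTC2 _ _ (fun p : R => p ^+ 2)%R)//.
- by rewrite expr1n expr0n/= sube0.
- by apply: continuous_subspaceT; exact: mulrl_continuous.
- split => [x _||]; first exact: ex_derive.
  + by apply: cvg_at_right_filter; exact: exprn_continuous.
  + by apply: cvg_at_left_filter; exact: exprn_continuous.
- move=> x _; rewrite derive1E; apply: derive_val.
  apply: is_derive_eq; rewrite /GRing.scale/=; ring.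
Qed.

Lemma ge0_integral_sign (e : bool) (g : T -> \bar R) :
  measurable_fun setT g -> (forall t, 0 <= g t) ->
  \int[mu]_t g ((-1) ^+ e * t)%R = \int[mu]_t g t.
Proof.
move=> mg g0; case: e; last by under eq_integral do rewrite expr0 mul1r.
by rewrite expr1 -[RHS]ge0_integral_opp//; under eq_integral do rewrite mulN1r.
Qed.

(** The integrand has degree 0 in the point, so by scaling the slice at squared norm p contributes 2
    p times a fixed integral, and 2 p integrates to 1 over the range of p. *)
Lemma ge0_integral_zonal4 (a b c d : R) (g : T -> \bar R) :
  (a ^+ 2 + b ^+ 2 + c ^+ 2 + d ^+ 2 = 1)%R ->
  measurable_fun setT g -> (forall t, 0 <= g t) ->
  \int[m4]_p (g (linear4 a b c d p / Num.sqrt (sqnorm4 p))%R *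
              (\1_(`]0%R, 1%R] : set T) (sqnorm4 p))%:E) =
  pi%:E * \int[mu]_t (g t * (Num.sqrt (1 - t ^+ 2))%R%:E).
Proof.
move=> abcd mg g0.
pose k (q : T * T) := g (q.1 / Num.sqrt q.2)%R * (\1_(`]0%R, 1%R] : set T) q.2)%:E.
have msqrtV : measurable_fun setT (fun x : T => (Num.sqrt x)^-1%R).
  rewrite (_ : (fun _ => _) = (fun x => (Num.sqrt x) `^ (-1))%R); last first.
    by apply/funext => x; rewrite powR_inv1// sqrtr_ge0.
  apply: (@measurableT_comp _ _ _ _ _ _ (@powR R ^~ (-1)%R) _ (@Num.sqrt R)).
    exact: measurable_powR.
  by apply: continuous_measurable_fun; exact: sqrt_continuous.
have mdiv : measurable_fun setT (fun q : T * T => (q.1 / Num.sqrt q.2)%R : T).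
  by apply: measurable_funM => //; exact: (measurableT_comp msqrtV).
have mI : measurable_fun [set: (T * T)%type]
    (fun q : T * T => (\1_(`]0%R, 1%R] : set T) q.2)%:E : \bar R).
  by apply/measurable_EFinP; apply: (measurableT_comp (measurable_indic _)).
have mk : measurable_fun setT k.
  by apply: emeasurable_funM => //; exact: measurableT_comp mg mdiv.
have k0 q : 0 <= k q by rewrite mule_ge0// lee_fin.
have [e ->] := @ge0_integral_linear4_rotation _ k mk k0 _ _ _ _ abcd.
pose s : R := ((-1) ^+ e)%R.
pose k' (q : T * T) := k ((s * q.1)%R, q.2).
have mk' : measurable_fun setT k'.
  by apply: (measurableT_comp mk); apply: measurable_fun_pair => //; exact: measurable_funM.
apply: etrans (ge0_integral_axial4 mk' (fun=> k0 _)) _.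
congr (_ * _).
have msq : measurable_fun setT (fun q : T * T => (2 * Num.sqrt (q.2 - q.1 ^+ 2))%R%:E).
  apply/measurable_EFinP; apply: measurable_funM => //.
  apply: (@measurableT_comp _ _ _ _ _ _ (@Num.sqrt R) _ (fun q : T * T => q.2 - q.1 ^+ 2)%R).
    by apply: continuous_measurable_fun; exact: sqrt_continuous.
  by apply: measurable_funB => //; apply: measurable_funX.
have mks : measurable_fun setT (fun q : T * T => k' q * (2 * Num.sqrt (q.2 - q.1 ^+ 2))%R%:E).
  exact: emeasurable_funM.
apply: etrans (@fubini_tonelli _ _ _ _ _ mu mu _ mks _) _.
  by move=> q; apply: mule_ge0; [exact: k0|rewrite lee_fin mulr_ge0// sqrtr_ge0].
set Z := RHS.
have Z0 : 0 <= Z.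
  by apply: integral_ge0 => t _; rewrite mule_ge0// lee_fin sqrtr_ge0.
transitivity (\int[mu]_(p in `]0%R, 1%R]) (Z * (2 * p)%R%:E)); last first.
  have m2p : measurable_fun (`]0%R, 1%R]%classic : set T) (fun p : T => (2 * p)%R%:E).
    by apply/measurable_EFinP; apply: measurable_funM.
  rewrite ge0_integralZl//; first by rewrite integral_2p mule1.
  by move=> p; rewrite /= in_itv/= => /andP[p0 _]; rewrite lee_fin mulr_ge0// ltW.
rewrite [RHS]integral_mkcond; apply: eq_integral => p _.
rewrite patchE; case: ifPn => [|np]; last first.
  apply: integral0_eq => x _; rewrite /k' /k/= indicE.
  by rewrite (negbTE np) mule0 mul0e.
rewrite inE/= => p01; have /andP[p0 p1] : (0 < p <= 1)%R by move: p01; rewrite in_itv.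
have mgs : measurable_fun setT (fun t : T => g (s * t)%R).
  by apply: (measurableT_comp mg); exact: measurable_funM.
transitivity (2%:E * (p%:E * \int[mu]_t (g (s * t)%R * (Num.sqrt (1 - t ^+ 2))%R%:E))).
  have mgp : measurable_fun setT
      (fun x : T => g (s * (x / Num.sqrt p))%R * (Num.sqrt (p - x ^+ 2))%R%:E).
    apply: emeasurable_funM; last first.
      by apply/measurable_EFinP; exact: measurable_sqrt_Bsqr.
    by apply: (measurableT_comp mgs); apply: measurable_funM.
  rewrite -(ge0_integral_halfdisc_scale p0 mgs)// -ge0_integralZl//; try
    by move=> x _; rewrite mule_ge0// lee_fin sqrtr_ge0.
  apply: eq_integral => x _; rewrite /k' /k/= indicE mem_set// mule1.
  by rewrite EFinM muleCA -mulrA.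
have -> : \int[mu]_t (g (s * t)%R * (Num.sqrt (1 - t ^+ 2))%R%:E) = Z.
  rewrite /Z -[RHS](@ge0_integral_sign e).
  - by apply: eq_integral => t _; rewrite -/s exprMn /s sqrr_sign mul1r.
  - apply: emeasurable_funM => //.
    by apply/measurable_EFinP; exact: measurable_sqrt_Bsqr.
  - by move=> t; rewrite mule_ge0// lee_fin sqrtr_ge0.
by rewrite muleA -EFinM muleC.
Qed.

End Axial.

(** * Integration over the sphere *)

Section Vol.
Context {R : realType}.
Local Notation T := (measurableTypeR R).
Local Notation mu := (@lebesgue_measure R).
Local Notation pushforward_measure :=
  measure_function_pushforward__canonical__measure_function_Measure.
Local Open Scope ereal_scope.
Local Notation m4 := (mu \x mu \x mu \x mu)%E.
Local Notation D := (`]0%R, 1%R]%classic : set T).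

Lemma sqnorm4E (p : T * T * T * T) : sqnorm4 p = dot (tuple_of_prod p) (tuple_of_prod p).
Proof. by rewrite /dot !big_ord_recl big_ord0 /sqnorm4/= /tnth/=; ring. Qed.

Lemma linear4E (y : 4.-tuple R) (p : T * T * T * T) :
  linear4 (tnth y ord0) (tnth y (lift ord0 ord0)) (tnth y (lift ord0 (lift ord0 ord0)))
    (tnth y (lift ord0 (lift ord0 (lift ord0 ord0)))) p = dot (tuple_of_prod p) y.
Proof.
rewrite /dot !big_ord_recl big_ord0 /linear4.
by rewrite [tnth (tuple_of_prod p) _]/= /tnth/=; ring.
Qed.

Lemma dot_radial_projection (x y : 4.-tuple R) :
  dot (radial_projection x) y = (dot x y / enorm x)%R.
Proof.
rewrite /dot mulr_suml; apply: eq_bigr => i _.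
by rewrite tnth_map mulrAC.
Qed.

Lemma dotC (x y : 4.-tuple R) : dot x y = dot y x.
Proof. by apply: eq_bigr => i _; rewrite mulrC. Qed.

Lemma S3_radial_projection (x : 4.-tuple R) : (0 < dot x x)%R -> S3 (radial_projection x).
Proof.
move=> x0; apply/S3P; rewrite dot_radial_projection dotC dot_radial_projection.
rewrite -mulrA -invfM -expr2 sqr_sqrtr ?ltW// divff// gt_eqF//.
Qed.

Lemma measurable_S3 : measurable (@S3 R).
Proof.
rewrite (_ : S3 = (@enorm R) @^-1` [set 1%R]); last by apply/seteqP; split.
rewrite -[X in measurable X]setTI.
exact: measurable_enorm.
Qed.

Lemma radial_cone_dom (p : T * T * T * T) :
  (0 < enorm (tuple_of_prod p) <= 1)%R <-> D (sqnorm4 p).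
Proof.
rewrite /= in_itv/= sqnorm4E /enorm sqrtr_gt0.
have -> (q : R) : (Num.sqrt q <= 1)%R = (q <= 1)%R.
  by rewrite -[X in (_ <= X)%R = _]sqrtr1 ler_sqrt.
by [].
Qed.

(** Radial projection on the punctured unit ball and the zero vector elsewhere. As zero is not on
    the sphere, restricting to [S3] discards everything outside the ball, and [vol] becomes 4 times
    the image of Lebesgue measure under this total measurable map. *)
Let phi (p : T * T * T * T) : 4.-tuple R :=
  [tuple (tnth (radial_projection (tuple_of_prod p)) i * \1_D (sqnorm4 p))%R | i < 4].

Let mphi : measurable_fun setT phi.
Proof.
apply/measurable_fun_tnthP => i.
rewrite (_ : _ \o _ = fun p => (tnth (radial_projection (tuple_of_prod p)) i *
    \1_D (sqnorm4 p))%R); last by apply/funext => p /=; rewrite tnth_mktuple.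
apply: measurable_funM.
  apply: (measurableT_comp (measurable_tnth i)).
  exact: (measurableT_comp measurable_radial_projection measurable_tuple_of_prod).
apply: (measurableT_comp (measurable_indic _)) => //.
exact: measurable_sqnorm4.
Qed.

Let phi_in p : D (sqnorm4 p) -> phi p = radial_projection (tuple_of_prod p).
Proof.
move=> Dp; apply: eq_from_tnth => i; rewrite tnth_mktuple indicE mem_set// mulr1//.
Qed.

Let phi_S3 p : S3 (phi p) <-> D (sqnorm4 p).
Proof.
split => [|Dp]; last first.
  rewrite phi_in//; apply: S3_radial_projection; rewrite -sqnorm4E.
  by move: Dp; rewrite /= in_itv/= => /andP[].
have [//|nD] := pselect (D (sqnorm4 p)).
move/S3P; rewrite /dot big1 => [/esym/eqP|i _]; first by rewrite oner_eq0.
by rewrite tnth_mktuple indicE memNset// mulr0 mul0r.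
Qed.

Let vol_phi (A : set (4.-tuple R)) : A `<=` S3 -> vol A = 4%:E * m4 (phi @^-1` A).
Proof.
move=> AS; rewrite /vol /lebesgue4; congr (_ * m4 _); apply/seteqP; split => p /=.
  by move=> [/radial_cone_dom Dp Ap]; rewrite phi_in.
move=> Ap; have Dp : D (sqnorm4 p) by apply/phi_S3/AS.
by split; [exact/radial_cone_dom|rewrite -phi_in].
Qed.

Lemma ge0_integral_vol (f : 4.-tuple R -> \bar R) : measurable_fun setT f ->
  (forall x, 0 <= f x) ->
  \int[vol]_(x in S3) f x = 4%:E * \int[m4]_p
    (f (radial_projection (tuple_of_prod p)) * (\1_D (sqnorm4 p))%:E).
Proof.
move=> mf f0; have m := measurable_S3.
have n4 : (0 <= 4 :> R)%R by [].
transitivity (\int[mscale (NngNum n4) (pushforward_measure m4 mphi)]_(x in S3) f x).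
  apply: eq_measure_integral => A mA AS.
  exact: (vol_phi AS).
rewrite ge0_integral_mscale//; last exact: measurable_funTS.
congr (_ * _); rewrite ge0_integral_pushforward//; last exact: measurable_funTS.
rewrite integral_mkcond; apply: eq_integral => p _; rewrite patchE.
have [Dp|nD] := pselect (D (sqnorm4 p)).
  by rewrite !mem_set//; [rewrite /= phi_in// indicE mem_set// mule1|exact/phi_S3].
by rewrite memNset; [rewrite indicE memNset// mule0|move/phi_S3].
Qed.

Lemma measurable_dot (y : 4.-tuple R) : measurable_fun setT (fun x : 4.-tuple R => dot x y : T).
Proof.
apply: measurable_sum => i; apply: measurable_funM => //; exact: measurable_tnth.
Qed.

(** The weight is the classical one: the parallel at height t is a 2-sphere of area 4 pi (1 - t^2),
    and arc length contributes dt / sqrt (1 - t^2). *)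
Lemma ge0_integral_zonal (y : 4.-tuple R) (g : T -> \bar R) : S3 y ->
  measurable_fun setT g -> (forall t, 0 <= g t) ->
  \int[vol]_(x in S3) g (dot x y) =
  (4 * pi)%:E * \int[mu]_t (g t * (Num.sqrt (1 - t ^+ 2))%R%:E).
Proof.
move=> /S3P Sy mg g0.
rewrite (ge0_integral_vol (measurableT_comp mg (measurable_dot y)) (fun=> g0 _)).
rewrite EFinM -muleA; congr (_ * _).
move: Sy; rewrite /dot !big_ord_recl big_ord0 addr0 !addrA -!expr2 => Sy.
rewrite -(ge0_integral_zonal4 Sy mg g0); apply: eq_integral => p _.
by rewrite linear4E sqnorm4E -/(enorm _) -dot_radial_projection.
Qed.

End Vol.

(** * The kernel *)

Section Kernel.
Context {R : realType}.
Local Notation T := (measurableTypeR R).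
Local Notation mu := (@lebesgue_measure R).

(* [1 / sin (geodist x y / 2)] as a function of [dot x y]; it is 0 from 1 on. *)
Definition csc_half (t : R) : R := (Num.sqrt ((1 - t) / 2))^-1.

Lemma csc_half_ge0 t : 0 <= csc_half t.
Proof. by rewrite invr_ge0 sqrtr_ge0. Qed.

Lemma measurable_csc_half : measurable_fun [set: T] csc_half.
Proof.
rewrite (_ : csc_half = fun t => (Num.sqrt ((1 - t) / 2)) `^ (-1)); last first.
  by apply/funext => x; rewrite powR_inv1// sqrtr_ge0.
apply: (@measurableT_comp _ _ _ _ _ _ (@powR R ^~ (-1)) _ (fun t : T => Num.sqrt ((1 - t) / 2))).
  exact: measurable_powR.
apply: (@measurableT_comp _ _ _ _ _ _ (@Num.sqrt R)).
  by apply: continuous_measurable_fun; exact: sqrt_continuous.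
by apply: measurable_funM => //; apply: measurable_funB.
Qed.

Lemma csc_halfE (t : R) : t < 1 -> csc_half t = Num.sqrt 2 / Num.sqrt (1 - t).
Proof.
move=> t1; rewrite /csc_half sqrtrM ?subr_ge0 ?ltW// sqrtrV// invfM invrK mulrC//.
Qed.

Lemma csc_half1 t : 1 <= t -> csc_half t = 0.
Proof.
move=> t1; rewrite /csc_half ler0_sqrtr ?invr0//.
by rewrite pmulr_lle0 ?invr_gt0// subr_le0.
Qed.

Lemma csc_half_sqr (t : R) : t < 1 -> csc_half t ^+ 2 = 2 / (1 - t).
Proof.
move=> t1; have t1' : 0 < 1 - t by rewrite subr_gt0.
by rewrite csc_halfE// expr_div_n !sqr_sqrtr// ltW.
Qed.

Lemma sqrt_1Bsqr (t : R) : -1 <= t <= 1 ->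
  Num.sqrt (1 - t ^+ 2) = Num.sqrt (1 - t) * Num.sqrt (1 + t).
Proof. by move=> t1; rewrite -sqrtrM; [congr Num.sqrt; ring|lra]. Qed.

Let continuous_sqrt_affine (a b : R) : continuous (fun t : R => Num.sqrt (a + b * t)).
Proof.
move=> t; apply: (@continuous_comp _ _ _ (fun t : R => a + b * t)); last exact: sqrt_continuous.
by apply: cvgD; [exact: cvg_cst|exact: mulrl_continuous].
Qed.

Let is_derive_sqrt_affine (a b t : R) : 0 < a + b * t ->
  is_derive t (1 : R) (fun t : R => Num.sqrt (a + b * t)) (b / (2 * Num.sqrt (a + b * t))).
Proof.
move=> abt; have ds := is_derive1_sqrt abt.
have dl : is_derive t (1 : R) (fun t : R => a + b * t) b.
  apply: is_derive_eq; rewrite /GRing.scale/=. ring.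
have := @is_derive1_comp _ Num.sqrt (fun t : R => a + b * t) t _ _ ds dl.
by rewrite mulrC.
Qed.

Let continuous_mull (c : R) (g : R -> R) (t : R) :
  {for t, continuous g} -> {for t, continuous (fun x => c * g x)}.
Proof.
by move=> cg; apply: (@continuous_comp _ _ _ g ( *%R c)) => //; exact: mulrl_continuous.
Qed.

Local Open Scope ereal_scope.

(** The factor sqrt (1 - t) of the weight cancels the singularity, leaving sqrt 2 * sqrt (1 + t),
    which has an elementary primitive. *)
Lemma integral_csc_half :
  \int[mu]_t ((csc_half t)%:E * (Num.sqrt (1 - t ^+ 2))%R%:E) = (8 / 3)%R%:E.
Proof.
rewrite ge0_integral_1Bsqr.
have mk : measurable_fun (`[(-1)%R, 1%R[%classic : set T)
    (fun t : T => (csc_half t)%:E * (Num.sqrt (1 - t ^+ 2))%R%:E).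
  apply: measurable_funTS; apply: emeasurable_funM.
    by apply/measurable_EFinP; exact: measurable_csc_half.
  by apply/measurable_EFinP; exact: measurable_sqrt_Bsqr.
pose f (t : R) := (Num.sqrt 2 * Num.sqrt (1 + 1 * t))%R.
have cf : continuous f.
  move=> t; apply: (@continuous_mull (Num.sqrt 2) (fun t => Num.sqrt (1 + 1 * t))%R t).
  exact: continuous_sqrt_affine.
have mf : measurable_fun (`[(-1)%R, 1%R[%classic : set T) (fun t : T => (f t)%:E).
  by apply: measurable_funTS; apply/measurable_EFinP; exact: continuous_measurable_fun.
(* The endpoint 1 is dropped because the kernel takes its default value 0 there, so the cancellation
   fails at that single point. *)
apply: etrans (esym (integral_itv_bndo_bndc mk)) _.
transitivity (\int[mu]_(t in `[(-1)%R, 1%R[) (f t)%:E).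
  apply: eq_integral => t; rewrite inE/= in_itv/= => /andP[t1 t2].
  rewrite csc_halfE// sqrt_1Bsqr ?t1 ?ltW// -EFinM /f mul1r; congr (_%:E).
  by rewrite mulrA divfK// gt_eqF// sqrtr_gt0 subr_gt0.
apply: etrans (integral_itv_bndo_bndc mf) _.
pose F (t : R) := (2 * Num.sqrt 2 / 3 * Num.sqrt (1 + 1 * t) ^+ 3)%R.
have cF : continuous F.
  move=> t; apply: (@continuous_mull (2 * Num.sqrt 2 / 3)%R (fun t => Num.sqrt (1 + 1 * t) ^+ 3)%R t).
  apply: (@continuous_comp _ _ _ (fun t : R => Num.sqrt (1 + 1 * t))%R (fun u : R => u ^+ 3)%R).
    exact: continuous_sqrt_affine.
  exact: exprn_continuous.
have dF (t : R) : (-1 < t)%R -> is_derive t 1%R F (f t).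
  move=> t1; have t1' : (0 < 1 + 1 * t)%R by lra.
  have d := is_derive_sqrt_affine t1'.
  rewrite /F; apply: is_derive_eq; rewrite /GRing.scale/= /f.
  have s0 : (0 < Num.sqrt (1 + 1 * t))%R by rewrite sqrtr_gt0.
  by field; rewrite lt0r_neq0.
rewrite (@continuous_FTC2 _ _ F).
- rewrite /F !mul1r subrr sqrtr0 expr0n/= mulr0 sube0; congr (_%:E).
  have e : (Num.sqrt 2 * Num.sqrt 2 = 2 :> R)%R by rewrite -expr2 sqr_sqrtr.
  rewrite (_ : 1 + 1 = 2)%R//.
  transitivity (2 / 3 * (Num.sqrt 2 * Num.sqrt 2) * (Num.sqrt 2 * Num.sqrt 2) : R)%R; first by field.
  by rewrite e; field.
- lra.
- exact: continuous_subspaceT.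
- split=> [x||].
  + by rewrite in_itv/= => /andP[x1 _]; have d := dF _ x1; exact: ex_derive.
  + by apply: cvg_at_right_filter; exact: cF.
  + by apply: cvg_at_left_filter; exact: cF.
- move=> x; rewrite in_itv/= => /andP[x1 _]; rewrite derive1E; have d := dF _ x1.
  exact: derive_val.
Qed.

(** Here a singularity 1 / sqrt (1 - t) survives. Bounding sqrt (1 + t) by sqrt 2 gives an
    elementary primitive, and the improper integral is exhausted by intervals that stop short of 1;
    each is at most 4 sqrt 2 * sqrt 2 = 8. *)
Lemma integral_csc_half_sqr_le :
  \int[mu]_t ((csc_half t ^+ 2)%R%:E * (Num.sqrt (1 - t ^+ 2))%R%:E) <= 8%:E.
Proof.
rewrite ge0_integral_1Bsqr.
pose g (t : T) := (csc_half t ^+ 2)%R%:E * (Num.sqrt (1 - t ^+ 2))%R%:E.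
have g0 t : 0 <= g t by rewrite mule_ge0// lee_fin ?sqr_ge0// sqrtr_ge0.
have mg : measurable_fun setT g.
  apply: emeasurable_funM.
    by apply/measurable_EFinP; apply: measurable_funX; exact: measurable_csc_half.
  by apply/measurable_EFinP; exact: measurable_sqrt_Bsqr.
rewrite -[leLHS](integral_itv_bndo_bndc (measurable_funTS mg)).
pose F n : set T := `[(-1)%R, (1 - n.+1%:R^-1)%R]%classic.
have -> : `[(-1)%R, 1%R[%classic = \bigcup_n F n.
  apply/seteqP; split => t; rewrite /F/= in_itv/=.
    move=> /andP[t1 t2]; have t3 : (0 < 1 - t)%R by rewrite subr_gt0.
    have [n _ /(_ n (leqnn _))/= nt] := near_infty_natSinv_lt (PosNum t3).
    by exists n => //=; rewrite in_itv/= t1/= lerBrDr -lerBrDl ltW.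
  move=> [n _]/=; rewrite in_itv/= => /andP[-> /le_lt_trans]; apply.
  by rewrite ltrBlDr ltrDl invr_gt0.
have ndF : nondecreasing_seq F.
  move=> m n mn; rewrite subsetEset => t; rewrite /F/= !in_itv/= => /andP[-> /le_trans].
  apply; rewrite lerD2l lerN2 lef_pV2 ?posrE// ler_nat ltnS//.
apply: cvge_le (ge0_nondecreasing_set_cvg_integral ndF _ _ _); last 3 first.
- by move=> n; exact: measurable_itv.
- by move=> n; exact: measurable_funTS.
- by move=> n x _; exact: g0.
apply: nearW => n.
have b1 : (-1 < 1 - n.+1%:R^-1 :> R)%R.
  by rewrite ltrBrDl (@le_lt_trans _ _ 0%R)// subr_le0 invf_le1// ler1n.
have b2 : (1 - n.+1%:R^-1 < 1 :> R)%R by rewrite ltrBlDr ltrDl invr_gt0.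
set b : R := (1 - n.+1%:R^-1)%R in b1 b2.
pose f (t : R) := (2 * Num.sqrt 2 / Num.sqrt (1 + (-1) * t))%R.
pose G (t : R) := (- (4 * Num.sqrt 2) * Num.sqrt (1 + (-1) * t))%R.
have s0 t : (t <= b)%R -> (0 < Num.sqrt (1 + (-1) * t))%R by move=> tb; rewrite sqrtr_gt0; lra.
have cf : {within `[(-1)%R, b], continuous f}.
  apply: continuous_in_subspaceT => t; rewrite inE/= in_itv/= => /andP[_ tb].
  apply: (@continuous_mull (2 * Num.sqrt 2)%R (fun t => (Num.sqrt (1 + (-1) * t))^-1)%R t).
  apply: continuousV; first by rewrite gt_eqF// s0.
  exact: continuous_sqrt_affine.
have cG : continuous G.
  move=> t; apply: (@continuous_mull (- (4 * Num.sqrt 2))%R (fun t => Num.sqrt (1 + (-1) * t))%R t).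
  exact: continuous_sqrt_affine.
have dG (t : R) : (t <= b)%R -> is_derive t 1%R G (f t).
  move=> tb; have t1' : (0 < 1 + (-1) * t)%R by rewrite -sqrtr_gt0 s0.
  have d := is_derive_sqrt_affine t1'.
  rewrite /G; apply: is_derive_eq; rewrite /GRing.scale/= /f.
  by field; rewrite lt0r_neq0// s0.
apply: (@le_trans _ _ (\int[mu]_(t in `[(-1)%R, b]) (f t)%:E)).
  apply: ge0_le_integral => //.
  - exact: measurable_itv.
  - exact: measurable_funTS.
  - by apply/measurable_EFinP; apply: subspace_continuous_measurable_fun; [exact: measurable_itv|exact: cf].
  - move=> t; rewrite /F/= in_itv/= -/b => /andP[t1 tb]; rewrite /g /f -EFinM.
    have tl : (t < 1)%R := le_lt_trans tb b2.
    rewrite csc_half_sqr// sqrt_1Bsqr; last by rewrite t1 ltW.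
    have st0 : (0 < Num.sqrt (1 - t))%R by rewrite sqrtr_gt0 subr_gt0.
    have -> : (2 / (1 - t) * (Num.sqrt (1 - t) * Num.sqrt (1 + t)) =
        2 * Num.sqrt (1 + t) / Num.sqrt (1 - t))%R.
      rewrite -{1}(@sqr_sqrtr _ (1 - t)%R) ?subr_ge0 ?ltW//.
      by field; rewrite lt0r_neq0.
    rewrite mulN1r lee_fin.
    by rewrite ler_pM2r ?invr_gt0// ler_pM2l// ler_wsqrtr//; lra.
rewrite (@continuous_FTC2 _ _ G)//.
- rewrite -EFinB lee_fin /G.
  have e : (Num.sqrt 2 * Num.sqrt 2 = 2 :> R)%R by rewrite -expr2 sqr_sqrtr.
  have -> : (1 + -1 * -1 = 2 :> R)%R by lra.
  have : (0 <= Num.sqrt 2 * Num.sqrt (1 + -1 * b) :> R)%R by rewrite mulr_ge0// sqrtr_ge0.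
  set u := (Num.sqrt 2 * Num.sqrt (1 + -1 * b))%R => u0.
  have -> : (- (4 * Num.sqrt 2) * Num.sqrt (1 + -1 * b) - - (4 * Num.sqrt 2) * Num.sqrt 2 =
     4 * (Num.sqrt 2 * Num.sqrt 2) - 4 * u)%R by rewrite /u; ring.
  by rewrite e; lra.
- split=> [x||].
  + by rewrite in_itv/= => /andP[_ xb]; have d := dG _ (ltW xb); exact: ex_derive.
  + by apply: cvg_at_right_filter; exact: cG.
  + by apply: cvg_at_left_filter; exact: cG.
- move=> x; rewrite in_itv/= => /andP[_ xb]; rewrite derive1E; have d := dG _ (ltW xb).
  exact: derive_val.
Qed.

End Kernel.

(** * Integrals of the kernel over the sphere, and null great spheres *)

Section SphereIntegrals.
Context {R : realType}.
Local Notation T := (measurableTypeR R).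
Local Notation mu := (@lebesgue_measure R).
Implicit Types x y : 4.-tuple R.

(** Expand the nonnegative squared norms of x + y and x - y. *)
Lemma S3_dot_bound x y : S3 x -> S3 y -> -1 <= dot x y <= 1.
Proof.
move=> /S3P Sx /S3P Sy.
have e (s : R) : \sum_(i < 4) (tnth x i + s * tnth y i) ^+ 2 = 1 + 2 * s * dot x y + s ^+ 2.
  rewrite -[X in X + _ + _]Sx -[X in _ + X]mulr1 -[in X in _ + X]Sy /dot !mulr_sumr -!big_split/=.
  by apply: eq_bigr => i _; ring.
have p (s : R) : 0 <= 1 + 2 * s * dot x y + s ^+ 2.
  by rewrite -e sumr_ge0// => i _; exact: sqr_ge0.
by have := p 1; have := p (-1); lra.
Qed.

(** The half-angle formula, with a nonnegative sine because the distance lies in [0, pi]. It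
    persists at x = y, where both sides invert 0. *)
Lemma sin_half_geodist x y : S3 x -> S3 y ->
  (sin (geodist x y / 2))^-1 = csc_half (dot x y).
Proof.
move=> Sx Sy; have d1 := S3_dot_bound Sx Sy.
rewrite /csc_half; congr (_^-1); set th := geodist x y / 2.
have th0 : 0 <= geodist x y by exact: acos_ge0.
have th1 : geodist x y <= pi by exact: acos_lepi.
have s0 : 0 <= sin th by apply: sin_ge0_pi; rewrite /th; apply/andP; split; lra.
have c : cos (geodist x y) = dot x y by rewrite acosK// in_itv.
have := cos_mulr2n th; rewrite (_ : th *+ 2 = geodist x y); last first.
  by rewrite /th -mulr_natr divfK.
rewrite c => ->; have := cos2Dsin2 th => cs.
rewrite (_ : (1 - _) / 2 = sin th ^+ 2) ?sqrtr_sqr ?ger0_norm//.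
rewrite -mulr_natr; lra.
Qed.

Local Open Scope ereal_scope.

Lemma vol_S3 : vol (@S3 R) = (2 * pi ^+ 2)%:E.
Proof.
pose y : 4.-tuple R := face_center (ord0, false).
have Sy : S3 y.
  apply/S3P; rewrite dot_face_center expr0 mul1r /y tnth_mktuple eqxx//.
have := ge0_integral_zonal (g := cst 1) Sy (measurable_cst _) (fun=> lee01).
rewrite integral_cst; last exact: measurable_S3.
rewrite mul1e => ->; under eq_integral do rewrite mul1e.
by rewrite integral_sqrt_1Bsqr -EFinM; congr (_%:E); lra.
Qed.

Lemma integral_csc_half_S3 y : S3 y ->
  \int[vol]_(x in S3) (csc_half (dot x y))%:E = (32 / 3 * pi)%:E.
Proof.
move=> Sy.
have mk : measurable_fun [set: T] (fun t : T => (csc_half t)%:E).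
  by apply/measurable_EFinP; exact: measurable_csc_half.
rewrite (ge0_integral_zonal Sy mk) => [|t]; last by rewrite lee_fin csc_half_ge0.
by rewrite integral_csc_half -EFinM; congr (_%:E); field.
Qed.

Lemma integral_csc_half_sqr_S3_le y : S3 y ->
  \int[vol]_(x in S3) (csc_half (dot x y) ^+ 2)%:E <= (32 * pi)%:E.
Proof.
move=> Sy; have pi0 := pi_ge0 R.
have mk : measurable_fun [set: T] (fun t : T => (csc_half t ^+ 2)%:E).
  by apply/measurable_EFinP; apply: measurable_funX; exact: measurable_csc_half.
rewrite (ge0_integral_zonal Sy mk) => [|t]; last by rewrite lee_fin sqr_ge0.
rewrite (_ : (32 * pi)%:E = (4 * pi)%:E * 8%:E); last by rewrite -EFinM; congr (_%:E); ring.
apply: lee_wpmul2l; last exact: integral_csc_half_sqr_le.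
by rewrite lee_fin mulr_ge0.
Qed.

(** The zonal formula reduces this to the integral over a single point. It will make the common
    boundaries of cells negligible. *)
Lemma vol_great_sphere y : S3 y -> vol (S3 `&` [set x | dot x y = 0%R]) = 0.
Proof.
move=> Sy.
have m0 : measurable ([set 0%R] : set T) by exact: measurable_set1.
have mI : measurable_fun [set: T] (fun t : T => (\1_[set 0%R] t)%:E : \bar R).
  by apply/measurable_EFinP; exact: measurable_indic.
have mS : measurable ((dot ^~ y) @^-1` [set 0%R] : set (4.-tuple R)).
  rewrite -[X in measurable X]setTI; exact: (measurable_dot y).
transitivity (\int[vol]_(x in S3) (\1_[set 0%R] (dot x y) : R)%:E).
  by rewrite setIC -(integral_indic vol measurable_S3 mS).
rewrite (ge0_integral_zonal Sy mI) => [|t]; last by rewrite lee_fin.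
rewrite [X in _ * X](_ : _ = 0) ?mule0//.
transitivity (\int[mu]_(t in [set 0%R]) ((Num.sqrt (1 - t ^+ 2))%R%:E : \bar R)).
  rewrite [RHS]integral_mkcond; apply: eq_integral => t _; rewrite patchE indicE.
  by case: ifPn; rewrite ?mul1e ?mul0e.
exact: integral_set1.
Qed.

Lemma vol_hyperplane (k a : 'I_4) (th : R) : k != a ->
  vol (S3 `&` [set x | tnth x k = th * tnth x a])%R = 0.
Proof.
move=> ka; pose w2 : R := (1 + th ^+ 2)%R.
have w20 : (0 < w2)%R by rewrite ltr_wpDr// sqr_ge0.
pose w := Num.sqrt w2; have w0 : (0 < w)%R by rewrite sqrtr_gt0.
have ww : (w ^+ 2 = w2)%R by rewrite sqr_sqrtr// ltW.
(* The unit normal of the hyperplane. *)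
pose h : 4.-tuple R := [tuple (if i == k then w^-1 else if i == a then - th / w else 0)%R | i < 4].
have hk : tnth h k = w^-1%R by rewrite tnth_mktuple eqxx.
have ha : tnth h a = (- th / w)%R by rewrite tnth_mktuple eq_sym (negbTE ka) eqxx.
have dh x : dot x h = ((tnth x k - th * tnth x a) / w)%R.
  rewrite /dot (bigD1 k)//= (bigD1 a) 1?eq_sym//= big1 ?addr0 ?hk ?ha; first by ring.
  by move=> i /andP[ik ia]; rewrite tnth_mktuple (negbTE ik) (negbTE ia) mulr0.
have Sh : S3 h.
  apply/S3P; rewrite dh hk ha.
  have -> : ((w^-1 - th * (- th / w)) / w = w2 / w ^+ 2)%R.
    by rewrite /w2; field; rewrite lt0r_neq0.
  by rewrite -ww divff// expf_neq0// lt0r_neq0.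
rewrite -(vol_great_sphere Sh); congr (vol (_ `&` _)); apply/seteqP; split => x /=.
  by move=> e; rewrite dh e subrr mul0r.
by rewrite dh => /eqP; rewrite mulf_eq0 invr_eq0 (gt_eqF w0) orbF subr_eq0 => /eqP.
Qed.

End SphereIntegrals.

(** * Geometry of the quasi-cubes *)

Section Cells.
Context {R : realType}.
Implicit Types (x y : 4.-tuple R) (k : face).

Lemma center_preimage_get n (i : small_index n) :
  center_preimage i (get (center_preimage i : set (4.-tuple R))).
Proof. by have [x ex] := @center_preimageE R n i; apply: getPex; rewrite ex; exists x. Qed.

Lemma big_quasi_cube_coord k x : big_quasi_cube k x ->
  forall i, `|tnth x i| <= (-1) ^+ k.2 * tnth x k.1.
Proof. by move=> kx; exact: (big_quasi_cubeP k kx.1).1 kx. Qed.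

(** The axial coordinate dominates the other three, so its square is at least a quarter of the
    squared norm 1. *)
Lemma big_quasi_cube_axis k x : big_quasi_cube k x -> 1 / 2 <= (-1) ^+ k.2 * tnth x k.1.
Proof.
move=> kx; have := big_quasi_cube_coord kx; set s := _ * _ => xs.
have s0 : 0 <= s by rewrite (le_trans _ (xs ord0)).
have : 1 <= 4 * s ^+ 2.
  have /S3P e := kx.1; rewrite -[X in X <= _]e /dot.
  apply: (@le_trans _ _ (\sum_(i < 4) s ^+ 2)).
    apply: ler_sum => i _; rewrite -expr2 -[X in X <= _]real_normK ?num_real//.
    by rewrite ler_sqr ?nnegrE.
  by rewrite sumr_const card_ord -[leLHS]mulr_natl.
by move=> s1; nra.
Qed.

Lemma big_quasi_cube_le1 k x : big_quasi_cube k x -> (-1) ^+ k.2 * tnth x k.1 <= 1.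
Proof.
move=> kx; set s := _ * _; have /S3P := kx.1.
rewrite /dot (bigD1 k.1)//= => e.
have : 0 <= \sum_(i < 4 | i != k.1) tnth x i * tnth x i.
  by apply: sumr_ge0 => i _; rewrite -expr2 sqr_ge0.
have ss : s * s = tnth x k.1 * tnth x k.1.
  by rewrite /s -!expr2 exprMn sqrr_sign mul1r.
by move=> h; nra.
Qed.

Lemma big_quasi_cube_neq0 k x : big_quasi_cube k x -> tnth x k.1 != 0.
Proof.
move=> kx; apply/eqP => x0; have := big_quasi_cube_axis kx.
by rewrite x0 mulr0; lra.
Qed.

Lemma dot_sub_sqr x y : S3 x -> S3 y ->
  \sum_(i < 4) (tnth x i - tnth y i) ^+ 2 = 2 - 2 * dot x y.
Proof.
move=> /S3P Sx /S3P Sy.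
transitivity (dot x x + dot y y - 2 * dot x y); last by rewrite Sx Sy; ring.
rewrite /dot mulr_sumr -sumrN -!big_split/=.
by apply: eq_bigr => i _; ring.
Qed.

(** Pushing two points of the sphere radially outwards does not bring them closer: the squared
    distance becomes |x - y|^2 / (a b) plus a square. *)
Lemma dot_projective x y (a b : R) : S3 x -> S3 y -> 0 < a <= 1 -> 0 < b <= 1 ->
  2 - 2 * dot x y <= \sum_(i < 4) (tnth x i / a - tnth y i / b) ^+ 2.
Proof.
move=> Sx Sy /andP[a0 a1] /andP[b0 b1]; have d1 := S3_dot_bound Sx Sy.
have -> : \sum_(i < 4) (tnth x i / a - tnth y i / b) ^+ 2 =
    (a^-1 - b^-1) ^+ 2 + (2 - 2 * dot x y) / (a * b).
  transitivity (dot x x / a ^+ 2 + dot y y / b ^+ 2 - 2 * dot x y / (a * b)).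
    rewrite /dot mulr_sumr !mulr_suml -sumrN -!big_split/=.
    by apply: eq_bigr => i _; field; rewrite !gt_eqF.
  move/S3P : Sx => ->; move/S3P : Sy => ->; field; by rewrite !gt_eqF.
apply: (@le_trans _ _ ((2 - 2 * dot x y) / (a * b))); last by rewrite lerDr sqr_ge0.
rewrite ler_pdivlMr ?mulr_gt0//; apply: ler_piMr; first lra.
by nra.
Qed.

Section Small.
Variables (n : nat).
Hypothesis n0 : (0 < n)%N.
Let n0' : 0 < n%:R :> R. Proof. by rewrite ltr0n. Qed.

(** Dividing by the axial coordinates moves both points outwards onto a face of the cube, where they
    lie in a flat cube of side 2/n, of squared diameter 3 (2/n)^2. *)
Lemma quasi_cube_diam (i : small_index n) x y :
  small_quasi_cube i x -> small_quasi_cube i y -> 2 - 2 * dot x y <= 12 / n%:R ^+ 2.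
Proof.
case: i => k c [/= kx cx] [/= ky cy].
pose s : R := (-1) ^+ k.2.
pose a := s * tnth x k.1; pose b := s * tnth y k.1.
have a1 : 1 / 2 <= a <= 1.
  by apply/andP; split; [exact: big_quasi_cube_axis kx|exact: big_quasi_cube_le1 kx].
have b1 : 1 / 2 <= b <= 1.
  by apply/andP; split; [exact: big_quasi_cube_axis ky|exact: big_quasi_cube_le1 ky].
have a01 : 0 < a <= 1 by lra.
have b01 : 0 < b <= 1 by lra.
apply: le_trans (dot_projective kx.1 ky.1 a01 b01) _.
have xk0 := big_quasi_cube_neq0 kx; have yk0 := big_quasi_cube_neq0 ky.
have s2 : s * s = 1 by rewrite -expr2 sqrr_sign.
have s0 : s != 0 by rewrite signr_eq0.
have aE z : z / a = s * (z / tnth x k.1).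
  rewrite /a invfM mulrCA; congr (_ * _).
  by rewrite -[LHS]mul1r -s2 -mulrA divff// mulr1.
have bE z : z / b = s * (z / tnth y k.1).
  rewrite /b invfM mulrCA; congr (_ * _).
  by rewrite -[LHS]mul1r -s2 -mulrA divff// mulr1.
rewrite (bigD1_ord k.1)//= aE bE !divff// subrr expr0n/= add0r.
apply: (@le_trans _ _ (\sum_(j < 3) (2 / n%:R) ^+ 2)); last first.
  rewrite sumr_const card_ord -mulr_natl.
  by rewrite le_eqVlt; apply/orP; left; apply/eqP; field; rewrite gt_eqF.
apply: ler_sum => j _; rewrite aE bE -mulrBr exprMn sqrr_sign mul1r.
rewrite -[leLHS]real_normK ?num_real// ler_sqr ?nnegrE ?divr_ge0//.
have := cx j; have := cy j; rewrite /central_projection !tnth_mktuple => /= /andP[u1 u2] /andP[v1 v2].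
have e : 2 / n%:R * (c j).+1%:R = 2 / n%:R * (c j)%:R + 2 / n%:R :> R.
  by rewrite -[(c j).+1%:R]natr1 mulrDr mulr1.
rewrite e in u2 v2; rewrite ler_norml.
by apply/andP; split; lra.
Qed.

(** One coordinate with a difference of 1/(4n) is enough. It exists because a center keeps the
    margin 1/n to the walls of its small cube, and axial coordinates are at least 1/2; the three
    cases are equal, opposite and adjacent faces. *)
Lemma center_cell_sep (i j : small_index n) x y : i != j ->
  center_preimage i y -> small_quasi_cube j x ->
  (16 * n%:R ^+ 2)^-1 <= 2 - 2 * dot x y.
Proof.
case: i => k c; case: j => k' c' ij [/= ky cy] [/= k'x c'x].
rewrite -(dot_sub_sqr k'x.1 ky.1).
suff [m mP] : exists m, (4 * n%:R)^-1 <= `|tnth x m - tnth y m|.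
  rewrite (bigD1 m)//= -[X in X <= _]addr0 lerD ?sumr_ge0//; last by move=> *; exact: sqr_ge0.
  rewrite -[leRHS]real_normK ?num_real//.
  have -> : (16 * n%:R ^+ 2)^-1 = (4 * n%:R)^-1 ^+ 2 :> R by field; rewrite gt_eqF.
  by rewrite ler_sqr ?nnegrE// invr_ge0 mulr_ge0.
have n1 : (n%:R)^-1 <= 1 :> R by rewrite invf_le1// ler1n.
have -> : (4 * n%:R)^-1 = (n%:R)^-1 / 4 :> R by rewrite invfM mulrC.
have two (m m' : 'I_4) : (n%:R)^-1 / 2 <= `|tnth x m - tnth y m| + `|tnth x m' - tnth y m'| ->
    exists m, (n%:R)^-1 / 4 <= `|tnth x m - tnth y m|.
  move=> h; have [h1|h1] := leP ((n%:R)^-1 / 4) `|tnth x m - tnth y m|; first by exists m.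
  by exists m'; lra.
have nn (b : bool) (z : R) : (-1) ^+ b * z <= `|z|.
  by rewrite (le_trans (ler_norm _))// normrM normrX normrN1 expr1n mul1r.
have yax := big_quasi_cube_axis ky; have xax := big_quasi_cube_axis k'x.
have yc (l : 'I_3) : tnth y (lift k.1 l) =
    (-1 + 2 / n%:R * ((c l)%:R + 1 / 2)) * tnth y k.1.
  have := congr1 (fun t => tnth t l) cy; rewrite /central_projection /cube_center !tnth_mktuple => <-.
  by rewrite divfK// big_quasi_cube_neq0.
have cb (l : 'I_3) : `|-1 + 2 / n%:R * ((c l)%:R + 1 / 2) : R| <= 1 - (n%:R)^-1.
  have cn : (c l)%:R + 1 <= n%:R :> R by rewrite natr1 ler_nat.
  have cn' : 2 / n%:R * ((c l)%:R + 1) <= 2 :> R.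
    by rewrite mulrAC ler_pdivrMr// ler_wpM2l.
  have c0 : 0 <= 2 / n%:R * (c l)%:R :> R by rewrite !mulr_ge0.
  rewrite mulrDr mulr1 in cn'; rewrite mulrDr ler_norml.
  have -> : 2 / n%:R * (1 / 2) = (n%:R)^-1 :> R by field; rewrite gt_eqF.
  by apply/andP; split; lra.
have [kk|kk] := eqVneq k k'.
  have [l cl] : exists l, c l != c' l.
    apply/existsP; apply: contraR ij; rewrite negb_exists => /forallP cc.
    rewrite kk; apply/eqP; congr (_, _); apply/ffunP => l.
    by have := cc l; rewrite negbK => /eqP.
  apply: (two (lift k.1 l) k.1).
  have xk0 := big_quasi_cube_neq0 k'x; rewrite -kk in xk0 xax c'x.
  have := c'x l; rewrite /central_projection tnth_mktuple /=.
  set u := tnth x _ / _; set v : R := -1 + 2 / n%:R * ((c l)%:R + 1 / 2).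
  have -> : tnth x (lift k.1 l) = u * tnth x k.1 by rewrite divfK.
  rewrite yc -/v => /andP[u1 u2].
  have uv : (n%:R)^-1 <= `|u - v|.
    have e2 : 2 / n%:R * (1 / 2) = (n%:R)^-1 :> R by field; rewrite gt_eqF.
    have : (c l < c' l)%N || (c' l < c l)%N by rewrite -neq_ltn.
    move=> /orP[h|h].
      have : 2 / n%:R * ((c l)%:R + 1) <= 2 / n%:R * (c' l)%:R :> R.
        by rewrite ler_wpM2l ?divr_ge0// natr1 ler_nat.
      rewrite !mulrDr mulr1 => h1; rewrite (le_trans _ (ler_norm _))// /v mulrDr e2.
      have : 2 / n%:R = (n%:R)^-1 + (n%:R)^-1 :> R by lra.
      by lra.
    have : 2 / n%:R * (c' l).+1%:R <= 2 / n%:R * (c l)%:R :> R.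
      by rewrite ler_wpM2l ?divr_ge0// ler_nat.
    move=> h1; rewrite distrC (le_trans _ (ler_norm _))// /v mulrDr e2.
    by lra.
  have ya : `|tnth y k.1| <= 1.
    by rewrite (le_trans (big_quasi_cube_coord ky k.1))// big_quasi_cube_le1.
  have v1 : `|v| <= 1 by rewrite (le_trans (cb l))//; lra.
  have xa : 1 / 2 <= `|tnth x k.1| by rewrite (le_trans xax)// nn.
  (* Same face: the projections differ by 1/n in coordinate [l], hence the coordinates by 1/(2n) up
     to the change of the axial coordinate, which is the second index given to [two]. *)
  have -> : u * tnth x k.1 - v * tnth y k.1 =
      (u - v) * tnth x k.1 + v * (tnth x k.1 - tnth y k.1) by ring.
  set w := tnth x k.1 - tnth y k.1.
  have h1 : `|(u - v) * tnth x k.1| <= `|(u - v) * tnth x k.1 + v * w| + `|v * w|.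
    have -> : (u - v) * tnth x k.1 = ((u - v) * tnth x k.1 + v * w) - v * w by ring.
    rewrite (le_trans (ler_normB _ _))//.
    by rewrite (_ : _ + _ - _ + _ = (u - v) * tnth x k.1 + v * w)//; ring.
  have h2 : `|v * w| <= `|w| by rewrite normrM ler_piMl.
  have h3 : (n%:R)^-1 * (1 / 2) <= `|(u - v) * tnth x k.1|.
    by rewrite normrM ler_pM// ?ltW.
  lra.
(* Opposite faces: the axial coordinates have opposite signs and size at least 1/2. *)
have [aa|aa] := eqVneq k.1 k'.1.
  exists k.1; rewrite -aa in xax.
  have bb : k'.2 = ~~ k.2.
    case: k k' kk aa {ky k'x cy c'x yax xax ij yc} => [a []] [a' []]//= kk aa;
      by rewrite aa eqxx in kk.
  rewrite bb in xax.
  have := nn k.2 (tnth y k.1 - tnth x k.1); rewrite distrC.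
  move: xax; rewrite signrN mulNr mulrBr => xax; lra.
(* Adjacent faces: in y, coordinate k'.1 is smaller than coordinate k.1 by the factor 1 - 1/n,
   whereas in x it is at least as large. The two changes add up to at least 1/(2n). *)
apply: (two k.1 k'.1).
have xk := big_quasi_cube_coord k'x k.1.
have yk : `|tnth y k'.1| <= (1 - (n%:R)^-1) * ((-1) ^+ k.2 * tnth y k.1).
  have [l ->|e] := unliftP k.1 k'.1; last by rewrite e eqxx in aa.
  rewrite yc normrM ler_pM//.
  exact: (big_quasi_cube_coord ky k.1).
have m1 := nn k.2 (tnth x k.1).
have m2 := nn k'.2 (tnth y k'.1).
have m3 := nn k.2 (tnth y k.1 - tnth x k.1).
have m4 := nn k'.2 (tnth x k'.1 - tnth y k'.1).
rewrite distrC in m3; rewrite mulrBr in m3; rewrite mulrBr in m4.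
set p := (-1) ^+ k.2 * tnth y k.1 in yk yax m3 *.
have : (n%:R)^-1 * (1 / 2) <= (n%:R)^-1 * p by rewrite ler_wpM2l// ltW.
lra.
Qed.

End Small.
End Cells.

(** * The cells are measurable, cover the sphere and overlap in hyperplanes *)

Section Partition.
Context {R : realType}.
Local Notation T := (measurableTypeR R).
Implicit Types (x y : 4.-tuple R) (k : face).
Variables (n : nat).
Hypothesis n0 : (0 < n)%N.
Let n0' : 0 < n%:R :> R. Proof. by rewrite ltr0n. Qed.

(** Cells are closed and share walls, each wall being a hyperplane through the origin: a ratio of
    coordinates is fixed by a grid value, or two coordinates agree up to sign. *)
Lemma quasi_cube_overlap (i j : small_index n) : i != j ->
  exists (k a : 'I_4) (th : R), k != a /\ forall x,
    small_quasi_cube i x -> small_quasi_cube j x -> tnth x k = th * tnth x a.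
Proof.
case: i => k c; case: j => k' c' ij.
have [kk|kk] := eqVneq k k'.
  have [l cl] : exists l, c l != c' l.
    apply/existsP; apply: contraR ij; rewrite negb_exists => /forallP cc.
    rewrite kk; apply/eqP; congr (_, _); apply/ffunP => l.
    by have := cc l; rewrite negbK => /eqP.
  subst k'; exists (lift k.1 l), k.1.
  (* A common value lies below the upper end of the lower interval and above the lower end of the
     higher one, which is this grid point. *)
  exists (-1 + 2 / n%:R * (maxn (c l) (c' l))%:R); split; first by rewrite eq_sym neq_lift.
  move=> x [/= kx cx] [/= _ c'x].
  rewrite -[LHS](divfK (big_quasi_cube_neq0 kx)); congr (_ * _).
  have := cx l; have := c'x l; rewrite /central_projection tnth_mktuple /=.
  have le (a b : nat) : (a < b)%N -> 2 / n%:R * a.+1%:R <= 2 / n%:R * b%:R :> R.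
    by move=> ab; rewrite ler_wpM2l ?divr_ge0// ler_nat.
  move: cl; rewrite neq_ltn => /orP[cl|cl].
    rewrite (maxn_idPr (ltnW cl)); have := le _ _ cl.
    by move=> h /andP[h1 h2] /andP[h3 h4]; apply/eqP; rewrite eq_le; apply/andP; split; lra.
  rewrite (maxn_idPl (ltnW cl)); have := le _ _ cl.
  by move=> h /andP[h1 h2] /andP[h3 h4]; apply/eqP; rewrite eq_le; apply/andP; split; lra.
have [aa|aa] := eqVneq k.1 k'.1.
  (* Opposite faces do not meet, so the witnesses are arbitrary. *)
  exists (lift k.1 ord0), k.1, 0; split; first by rewrite eq_sym neq_lift.
  move=> x [/= kx _] [/= k'x _].
  have := big_quasi_cube_axis kx; have := big_quasi_cube_axis k'x.
  rewrite -aa; have -> : k'.2 = ~~ k.2.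
    case: k k' kk aa {ij kx k'x} => [a []] [a' []]//= kk aa; by rewrite aa eqxx in kk.
  by rewrite signrN mulNr; lra.
exists k'.1, k.1, ((-1) ^+ k'.2 * (-1) ^+ k.2); split; first by rewrite eq_sym.
move=> x [/= kx _] [/= k'x _].
have nn (b : bool) (z : R) : (-1) ^+ b * z <= `|z|.
  by rewrite (le_trans (ler_norm _))// normrM normrX normrN1 expr1n mul1r.
have e : (-1) ^+ k'.2 * tnth x k'.1 = (-1) ^+ k.2 * tnth x k.1.
  apply/eqP; rewrite eq_le.
  rewrite (le_trans (nn _ _) (big_quasi_cube_coord kx k'.1)).
  by rewrite (le_trans (nn _ _) (big_quasi_cube_coord k'x k.1)).
by rewrite -mulrA -e mulrA -expr2 sqrr_sign mul1r.
Qed.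

Let subdivide (u : R) : -1 <= u <= 1 ->
  exists m : 'I_n, -1 + 2 / n%:R * m%:R <= u <= -1 + 2 / n%:R * m.+1%:R.
Proof.
move=> /andP[u1 u2]; pose t := (u + 1) * n%:R / 2.
have uE : u = -1 + 2 / n%:R * t by rewrite /t; field; rewrite gt_eqF.
have t0 : 0 <= t by rewrite divr_ge0// mulr_ge0 ?ler0n//; lra.
have tn : t <= n%:R by rewrite /t ler_pdivrMr// mulrC ler_wpM2l ?ler0n//; lra.
have le (a b : R) : a <= b -> -1 + 2 / n%:R * a <= -1 + 2 / n%:R * b.
  by move=> ab; rewrite lerD2l ler_wpM2l ?divr_ge0// ltW.
have [tln|tgn] := ltP t n%:R.
  have /andP[m1 m2] := truncn_itv t0.
  have mn : (Num.truncn t < n)%N by rewrite -(ltr_nat R) (le_lt_trans m1).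
  by exists (Ordinal mn); rewrite uE !le// ltW.
(* The right end u = 1 belongs to the last interval, which truncation would miss. *)
have n1 : (n.-1 < n)%N by rewrite prednK.
exists (Ordinal n1); rewrite uE/= !le//; first by rewrite prednK.
by rewrite (le_trans _ tgn)// ler_nat leq_pred.
Qed.

Lemma quasi_cube_cover x : S3 x -> exists i : small_index n, small_quasi_cube i x.
Proof.
move=> Sx.
pose a := [arg max_(a > (ord0 : 'I_4)) `|tnth x a|]%O.
have amax i : `|tnth x i| <= `|tnth x a|.
  by rewrite /a; case: arg_maxP => // b _; apply.
pose k : face := (a, tnth x a < 0).
have sxa : (-1) ^+ k.2 * tnth x k.1 = `|tnth x a|.
  rewrite /k/=; have [xa|xa] := ltP (tnth x a) 0; first by rewrite expr1 mulN1r ltr0_norm.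
  by rewrite expr0 mul1r ger0_norm.
have kx : big_quasi_cube k x by apply/(big_quasi_cubeP k Sx) => i; rewrite sxa.
have /choice[f fP] : forall l : 'I_3, exists m : 'I_n,
    -1 + 2 / n%:R * m%:R <= tnth (central_projection k x) l <= -1 + 2 / n%:R * m.+1%:R.
  move=> l; apply: subdivide; rewrite -ler_norml tnth_mktuple normf_div.
  by rewrite ler_pdivrMr ?mul1r// normr_gt0 big_quasi_cube_neq0.
exists (k, [ffun l => f l]); split => //= l; rewrite ffunE; exact: fP.
Qed.

Let measurable_le (f g : 4.-tuple R -> T) : measurable_fun setT f -> measurable_fun setT g ->
  measurable [set x | f x <= g x].
Proof.
move=> mf mg; have mfg := measurable_funB mf mg.
rewrite (_ : [set _ | _] = (f \- g) @^-1` (`]-oo, 0] : set T)).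
  by rewrite -[X in measurable X]setTI; exact: mfg.
by apply/seteqP; split => x; rewrite /= in_itv/= subr_le0.
Qed.

(** Multiplying by the axial coordinate, positive up to its sign, turns the bounds on quotients into
    linear inequalities. *)
Lemma measurable_small_quasi_cube (i : small_index n) :
  measurable (small_quasi_cube i : set (4.-tuple R)).
Proof.
case: i => k c; pose s : R := (-1) ^+ k.2.
have s2 : s * s = 1 by rewrite -expr2 sqrr_sign.
have s0 : s != 0 by rewrite signr_eq0.
have mt (m : 'I_4) (r : R) : measurable_fun setT (fun x : 4.-tuple R => r * tnth x m : T).
  by apply: measurable_funM => //; exact: measurable_tnth.
rewrite (_ : small_quasi_cube _ = S3 `&`
   ((\bigcap_(m in [set: 'I_4]) [set x | `|tnth x m| <= s * tnth x k.1]) `&`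
   ((\bigcap_(l in [set: 'I_3])
      [set x | (-1 + 2 / n%:R * (c l)%:R) * s * tnth x k.1 <= s * tnth x (lift k.1 l)]) `&`
   (\bigcap_(l in [set: 'I_3])
      [set x | s * tnth x (lift k.1 l) <= (-1 + 2 / n%:R * (c l).+1%:R) * s * tnth x k.1])))).
  apply: measurableI; first exact: measurable_S3.
  apply: measurableI; last apply: measurableI.
  - apply: fin_bigcap_measurable => // m _; apply: measurable_le => //.
    apply: (@measurableT_comp _ _ _ _ _ _ (fun z : T => `|z| : T) _ (fun x : 4.-tuple R => tnth x m : T)).
      exact: normr_measurable.
    exact: measurable_tnth.
  - by apply: fin_bigcap_measurable => // l _; exact: measurable_le.
  - by apply: fin_bigcap_measurable => // l _; exact: measurable_le.
have uE x l : 0 < s * tnth x k.1 -> tnth (central_projection k x) l =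
    s * tnth x (lift k.1 l) / (s * tnth x k.1).
  move=> sx; rewrite tnth_mktuple invfM mulrACA divff// mul1r//.
apply/seteqP; split => x.
  move=> [/= kx cx]; have sx : 0 < s * tnth x k.1.
    by have := big_quasi_cube_axis kx; rewrite -/s; lra.
  split; first exact: kx.1.
  split; first by move=> m _; exact: big_quasi_cube_coord kx m.
  split=> l _ /=; have := cx l; rewrite uE// ler_pdivlMr// ler_pdivrMr//.
    by rewrite mulrA => /andP[].
  by rewrite mulrA => /andP[_]; rewrite mulrA.
move=> [Sx [xm [x1 x2]]].
have kx : big_quasi_cube k x by apply/(big_quasi_cubeP k Sx) => m; exact: xm.
split => //= l; have sx : 0 < s * tnth x k.1.
  by have := big_quasi_cube_axis kx; rewrite -/s; lra.
rewrite uE// ler_pdivlMr// ler_pdivrMr// !mulrA.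
by apply/andP; split; [exact: (x1 l I)|exact: (x2 l I)].
Qed.

End Partition.

(** * Chordal distance and oscillation of the kernel on a cell *)

Section Chord.
Context {R : realType}.
Implicit Types (x y : 4.-tuple R).

Lemma cauchy_schwarz4 (f g : 'I_4 -> R) :
  (\sum_i f i * g i) ^+ 2 <= (\sum_i f i ^+ 2) * (\sum_i g i ^+ 2).
Proof.
rewrite !big_ord_recl !big_ord0 !addr0 -subr_ge0.
set f0 := f _; set f1 := f _; set f2 := f _; set f3 := f _.
set g0 := g _; set g1 := g _; set g2 := g _; set g3 := g _.
(* Lagrange's identity. *)
rewrite (_ : _ - _ = (f0 * g1 - f1 * g0) ^+ 2 + (f0 * g2 - f2 * g0) ^+ 2 +
  (f0 * g3 - f3 * g0) ^+ 2 + (f1 * g2 - f2 * g1) ^+ 2 + (f1 * g3 - f3 * g1) ^+ 2 +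
  (f2 * g3 - f3 * g2) ^+ 2); last by ring.
by rewrite !addr_ge0// sqr_ge0.
Qed.

Lemma minkowski4 (f g : 'I_4 -> R) :
  Num.sqrt (\sum_i (f i + g i) ^+ 2) <=
  Num.sqrt (\sum_i f i ^+ 2) + Num.sqrt (\sum_i g i ^+ 2).
Proof.
have f0 : 0 <= \sum_i f i ^+ 2 by apply: sumr_ge0 => i _; exact: sqr_ge0.
have g0 : 0 <= \sum_i g i ^+ 2 by apply: sumr_ge0 => i _; exact: sqr_ge0.
have fg0 : 0 <= \sum_i (f i + g i) ^+ 2 by apply: sumr_ge0 => i _; exact: sqr_ge0.
rewrite -ler_sqr ?nnegrE ?addr_ge0 ?sqrtr_ge0// sqr_sqrtr// sqrrD !sqr_sqrtr//.
have -> : \sum_i (f i + g i) ^+ 2 =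
    \sum_i f i ^+ 2 + (\sum_i f i * g i) *+ 2 + \sum_i g i ^+ 2.
  by rewrite -sumrMnl -!big_split/=; apply: eq_bigr => i _; rewrite sqrrD.
rewrite lerD2r lerD2l lerMn2r/= (le_trans (ler_norm _))//.
by rewrite -sqrtr_sqr -sqrtrM// ler_wsqrtr// cauchy_schwarz4.
Qed.

Definition chord x y : R := Num.sqrt (2 - 2 * dot x y).

Lemma chord_triangle x y z : S3 x -> S3 y -> S3 z -> chord x z <= chord x y + chord y z.
Proof.
move=> Sx Sy Sz; rewrite /chord -!dot_sub_sqr//.
apply: le_trans (minkowski4 _ _); apply: ler_wsqrtr.
by apply: ler_sum => i _; rewrite subrKA.
Qed.

Lemma chordC x y : chord x y = chord y x.
Proof. by rewrite /chord dotC. Qed.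

Lemma csc_half_chord x y : csc_half (dot x y) = 2 / chord x y.
Proof.
have [d1|d1] := ltP (dot x y) 1; last first.
  by rewrite csc_half1// /chord ler0_sqrtr ?invr0 ?mulr0//; lra.
have d1' : 0 < 1 - dot x y by rewrite subr_gt0.
rewrite csc_halfE// /chord (_ : 2 - 2 * dot x y = 2 * (1 - dot x y)); last by ring.
rewrite sqrtrM//.
have s0 : 0 < Num.sqrt (1 - dot x y) by rewrite sqrtr_gt0.
have s20 : 0 < Num.sqrt 2 :> R by rewrite sqrtr_gt0.
have e : Num.sqrt 2 * Num.sqrt 2 = 2 :> R by rewrite -expr2 sqr_sqrtr.
transitivity (Num.sqrt 2 * Num.sqrt 2 / (Num.sqrt 2 * Num.sqrt (1 - dot x y))); last by rewrite e.
by field; rewrite !lt0r_neq0.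
Qed.

Variables (n : nat).
Hypothesis n0 : (0 < n)%N.
Let n0' : 0 < n%:R :> R. Proof. by rewrite ltr0n. Qed.

(** The bound sqrt 12 / n, rounded up. *)
Lemma chord_cell (i : small_index n) x y :
  small_quasi_cube i x -> small_quasi_cube i y -> chord x y <= 4 / n%:R.
Proof.
move=> ix iy; have h := quasi_cube_diam n0 ix iy.
rewrite /chord -[leRHS]ger0_norm ?divr_ge0// -sqrtr_sqr; apply: ler_wsqrtr.
apply: (le_trans h); rewrite expr_div_n ler_pM2r ?invr_gt0 ?exprn_gt0//.
lra.
Qed.

Lemma chord_center_cell (i j : small_index n) x y : i != j ->
  center_preimage i y -> small_quasi_cube j x -> (4 * n%:R)^-1 <= chord x y.
Proof.
move=> ij iy jx; have h := center_cell_sep n0 ij iy jx.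
rewrite /chord -[leLHS]ger0_norm ?invr_ge0 ?mulr_ge0// -sqrtr_sqr; apply: ler_wsqrtr.
by apply: le_trans h; rewrite le_eqVlt; apply/orP; left; apply/eqP; field; rewrite gt_eqF.
Qed.

(** The Riemann-sum error, with [x'] in the role of the puncture: comparability of the two distances
    allows the bound to involve only the variable point [x], so that it can be integrated over the
    cell. *)
Lemma csc_half_other_cell (i j : small_index n) x x' y : i != j ->
  center_preimage i y -> small_quasi_cube j x -> small_quasi_cube j x' ->
  `|csc_half (dot x' y) - csc_half (dot x y)| <= 34 / n%:R * csc_half (dot x y) ^+ 2.
Proof.
move=> ij iy jx jx'; rewrite !csc_half_chord.
have A1 := chord_center_cell ij iy jx'; have B1 := chord_center_cell ij iy jx.
have D1 := chord_cell jx jx'.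
have Sx := jx.1.1; have Sx' := jx'.1.1; have Sy := iy.1.1.
have t1 := chord_triangle Sx Sx' Sy; have t2 := chord_triangle Sx' Sx Sy.
rewrite (chordC x' x) in t2.
move: A1 B1 D1 t1 t2; set A := chord x' y; set B := chord x y; set D := chord x x'.
have q0 : 0 < (4 * n%:R)^-1 :> R by rewrite invr_gt0 mulr_gt0.
have e : 4 / n%:R = 16 * (4 * n%:R)^-1 :> R by field; rewrite gt_eqF.
move=> A1 B1 D1 t1 t2.
have A0 : 0 < A := lt_le_trans q0 A1.
have B0 : 0 < B := lt_le_trans q0 B1.
have BA : B <= 17 * A by rewrite e in D1; lra.
have AB : `|B - A| <= 4 / n%:R by rewrite ler_norml; apply/andP; split; lra.
have -> : 2 / A - 2 / B = 2 * (B - A) / (A * B) by field; rewrite !gt_eqF.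
rewrite normrM normfV (gtr0_norm (mulr_gt0 A0 B0)) normrM (@ger0_norm _ 2)//.
rewrite ler_pdivrMr ?mulr_gt0//.
have -> : 34 / n%:R * (2 / B) ^+ 2 * (A * B) = 2 * (4 / n%:R * (17 * A / B)).
  by field; rewrite !gt_eqF.
rewrite ler_pM2l//; apply: (le_trans AB); apply: ler_peMr; first by rewrite divr_ge0.
by rewrite ler_pdivlMr// mul1r.
Qed.

(** On a cell containing the pole the kernel is at least n/2 away from the pole, so it is dominated
    by its square over n; the constant 34 is generous and matches the other cells. *)
Lemma csc_half_same_cell (i : small_index n) x y :
  small_quasi_cube i x -> small_quasi_cube i y ->
  csc_half (dot x y) <= 34 / n%:R * csc_half (dot x y) ^+ 2.
Proof.
move=> ix iy; rewrite csc_half_chord; have := chord_cell ix iy.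
set B := chord x y => Bn; have [B0|B0] := eqVneq B 0.
  by rewrite B0 invr0 mulr0 expr0n mulr0.
have {}B0 : 0 < B by rewrite lt_def B0 sqrtr_ge0.
have -> : 34 / n%:R * (2 / B) ^+ 2 = (17 * (4 / n%:R) / B) * (2 / B).
  by field; rewrite !gt_eqF.
apply: ler_peMl; first by rewrite divr_ge0// ltW.
by rewrite ler_pdivlMr// mul1r; lra.
Qed.

End Chord.

(** * Splitting integrals over the cells *)

Section Sums.
Context {R : realType}.
Local Notation T := (measurableTypeR R).
Variables (n : nat).
Hypothesis n0 : (0 < n)%N.
Implicit Types (x y : 4.-tuple R) (i j : small_index n).
Local Notation cell i := (small_quasi_cube i : set (4.-tuple R)).
Local Open Scope ereal_scope.

Let cell_S3 i : cell i `<=` S3.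
Proof. by move=> x ix; exact: ix.1.1. Qed.

Let ae_disjoint : {ae (@vol R), forall x, forall i j, i != j -> ~ (cell i x /\ cell j x)}.
Proof.
apply: filter_forall => i; apply: filter_forall => j.
have [->|ij] := eqVneq i j; first by apply: aeW.
have [k [a [th [ka H]]]] := @quasi_cube_overlap R n i j ij.
have mS : measurable (S3 `&` [set x | tnth x k = th * tnth x a]%R).
  apply: measurableI; first exact: measurable_S3.
  rewrite (_ : [set _ | _] = (fun x : 4.-tuple R => tnth x k - th * tnth x a : T)%R @^-1` [set 0%R]).
    rewrite -[X in measurable X]setTI.
    have m : measurable_fun setT (fun x : 4.-tuple R => tnth x k - th * tnth x a : T)%R.
      apply: measurable_funB; first exact: measurable_tnth.
      by apply: measurable_funM => //; exact: measurable_tnth.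
    exact: m.
  by apply/seteqP; split => x /= => [->|/eqP]; [rewrite subrr|rewrite subr_eq0 => /eqP].
exists (S3 `&` [set x | tnth x k = th * tnth x a]%R); split => //.
  exact: vol_hyperplane.
move=> x /= h; have [ix jx] : cell i x /\ cell j x.
  by apply: contrapT => nij; apply: h => _.
by split; [exact: ix.1.1|exact: H].
Qed.

(** Walls are counted several times, so the restrictions of [f] to the cells add up to [f] only
    almost everywhere. *)
Lemma ge0_integral_cells (f : 4.-tuple R -> \bar R) : measurable_fun setT f ->
  (forall x, 0 <= f x) ->
  \sum_(i : small_index n) \int[vol]_(x in cell i) f x = \int[vol]_(x in S3) f x.
Proof.
move=> mf f0.
have mc (i : small_index n) : measurable_fun (@S3 R) (f \_ (cell i)).
  apply: measurable_funTS; apply/(measurable_restrictT f).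
    exact: measurable_small_quasi_cube.
  exact: measurable_funTS.
have c0 (i : small_index n) x : 0 <= (f \_ (cell i)) x by rewrite patchE; case: ifP.
transitivity (\int[vol]_(x in S3) (\sum_(i : small_index n) (f \_ (cell i)) x)).
  rewrite (ge0_integral_sum _ measurable_S3 mc (fun i x _ => c0 i x)).
  apply: eq_bigr => i _.
  by rewrite -[X in \int[_]_(x in X) _ = _](setIidr (@cell_S3 i)) integral_mkcondr.
apply: ge0_ae_eq_integral.
- exact: measurable_S3.
- by apply: emeasurable_sum.
- exact: measurable_funTS.
- by move=> x _; apply: sume_ge0.
- by move=> x _; exact: f0.
apply: filterS ae_disjoint => x dx Sx.
have [i ix] := @quasi_cube_cover R n n0 x Sx.
rewrite (bigD1 i)//= big1 ?adde0 => [|j ji]; first by rewrite patchE mem_set.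
by rewrite patchE memNset// => jx; apply: (dx j i ji).
Qed.

End Sums.

(** * The mass deficit *)

(** Moves a bounded sum of nonnegative integrals to [R], where the estimates become linear
    arithmetic. *)
Lemma fin_ge0_sum (R : realType) (I : finType) (A : I -> \bar R) (r : R) :
  (forall i, 0 <= A i)%E -> (\sum_i A i <= r%:E)%E ->
  exists a : I -> R, [/\ forall i, A i = (a i)%:E, forall i, 0 <= a i &
    (\sum_i A i = (\sum_i a i)%:E)%E].
Proof.
move=> A0 Ar; exists (fine \o A).
have Af i : A i \is a fin_num.
  rewrite ge0_fin_numE//; apply: (@le_lt_trans _ _ r%:E); last exact: ltry.
  apply: le_trans Ar; rewrite (bigD1 i)//= leeDl//.
  by apply: sume_ge0.
split=> [i|i|]; [by rewrite /= fineK|by rewrite fine_ge0|].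
by rewrite -sumEFin; apply: eq_bigr => i _; rewrite /= fineK.
Qed.

Section Deficit.
Context {R : realType}.
Local Notation T := (measurableTypeR R).
Variables (n : nat).
Hypothesis n0 : (0 < n)%N.
Local Notation cell i := (small_quasi_cube i : set (4.-tuple R)).
Local Notation V := (2 * pi ^+ 2 : R).
Implicit Types (x y : 4.-tuple R).

Let n0' : 0 < n%:R :> R. Proof. by rewrite ltr0n. Qed.
Let pi0 : 0 < pi :> R := pi_gt0 R.

Let v (i : small_index n) : R := fine (vol (cell i)).
Let y (i : small_index n) : 4.-tuple R := get (center_preimage i).
Let c : R := 34 / n%:R.

Let c0 : 0 <= c. Proof. by rewrite divr_ge0. Qed.

Let yS (i : small_index n) : S3 (y i).
Proof. exact: (center_preimage_get i).1.1. Qed.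

Let yc (i : small_index n) : cell i (y i).
Proof.
have [b cp] := @center_preimage_get R n i.
split => // j; rewrite cp /cube_center tnth_mktuple.
have d0 : 0 <= 2 / n%:R :> R by rewrite divr_ge0.
rewrite !lerD2l; apply/andP; split; apply: ler_wpM2l => //; first by rewrite lerDl.
by rewrite -[leRHS]natr1 lerD2l; lra.
Qed.

Let vE : (forall i, vol (cell i) = (v i)%:E) /\ (forall i, 0 <= v i) /\ \sum_i v i = V.
Proof.
have := @ge0_integral_cells R n n0 (cst 1%E) (measurable_cst _) (fun=> lee01).
rewrite integral_cst ?mul1e; last exact: measurable_S3.
under eq_bigr => i _.
  rewrite integral_cst; last exact: measurable_small_quasi_cube.
  rewrite mul1e; over.
move=> s0.
have s : (\sum_(i : small_index n) vol (cell i) = V%:E)%E.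
  by apply: etrans (@vol_S3 R); exact: s0.
have sV : (\sum_(i : small_index n) vol (cell i) <= V%:E)%E by rewrite s.
have [a [aE a0 as_]] := fin_ge0_sum (fun i : small_index n => measure_ge0 vol (cell i)) sV.
have va i : v i = a i by rewrite /v aE.
split=> [i|]; first by rewrite va aE.
split=> [i|]; first by rewrite va.
by under eq_bigr do rewrite va; apply/EFin_inj; rewrite -as_ s.
Qed.

Let K (i : small_index n) x : R := csc_half (dot x (y i)).

Let mK i : measurable_fun setT (K i : _ -> T).
Proof. exact: (measurableT_comp measurable_csc_half (measurable_dot (y i))). Qed.

(** Used in both directions, with the kernel and its value at the puncture as [p] and [q], and with
    the squared kernel as [r]. *)
Let le_cell_integral (j : small_index n) (p q r : 4.-tuple R -> T) :
  measurable_fun setT p -> measurable_fun setT q -> measurable_fun setT r ->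
  (forall x, 0 <= p x) -> (forall x, 0 <= q x) -> (forall x, 0 <= r x) ->
  (forall x, cell j x -> p x <= q x + c * r x) ->
  (\int[vol]_(x in cell j) (p x)%:E <=
   \int[vol]_(x in cell j) (q x)%:E + c%:E * \int[vol]_(x in cell j) (r x)%:E)%E.
Proof.
move=> mp mq mr p0 q0 r0 h.
have mj : measurable (cell j) := measurable_small_quasi_cube j.
have mE (f : 4.-tuple R -> T) : measurable_fun setT f ->
    measurable_fun (cell j) (fun x => (f x)%:E).
  by move=> mf; apply: measurable_funTS; apply/measurable_EFinP.
have mcr : measurable_fun setT (fun x => c * r x : T) by exact: measurable_funM.
have cr0 x : 0 <= c * r x by rewrite mulr_ge0.
rewrite -(ge0_integralZl vol mj (mE _ mr))//; [|by move=> x _; rewrite lee_fin..].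
have q0' x : cell j x -> (0 <= (q x)%:E)%E by rewrite lee_fin.
have cr0' x : cell j x -> (0 <= (c * r x)%:E)%E by rewrite lee_fin.
rewrite -(ge0_integralD vol mj q0' (mE _ mq) cr0' (mE _ mcr)).
have p0' x : cell j x -> (0 <= (p x)%:E)%E by rewrite lee_fin.
have mp' := mE _ mp.
have mqr : measurable_fun (cell j) (fun x => ((q x)%:E + (c * r x)%:E)%E).
  by apply: (@emeasurable_funD _ _ _ _ (fun x => (q x)%:E) (fun x => (c * r x)%:E));
    [exact: mE|exact: (mE _ mcr)].
by apply: ge0_le_integral.
Qed.

Let S (i : small_index n) : R := \sum_(j | j != i) v j * K i (y j).

Lemma puncture_sum_bound i : `|S i - 32 / 3 * pi| <= c * (32 * pi).
Proof.
have [vE1 [v0 vV]] := vE.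
have mE (f : 4.-tuple R -> T) : measurable_fun setT f ->
    measurable_fun setT (fun x => (f x)%:E).
  by move=> mf; apply/measurable_EFinP.
have K0 x : 0 <= K i x := csc_half_ge0 _.
have mK2 : measurable_fun setT (fun x => K i x ^+ 2 : T) by apply: measurable_funX; exact: mK.
have sA := ge0_integral_cells n0 (mE _ (mK i)) (fun x => K0 x : (0 <= (K i x)%:E)%E).
rewrite integral_csc_half_S3// in sA.
have sB := ge0_integral_cells n0 (mE _ mK2) (fun x => sqr_ge0 (K i x) : (0 <= (K i x ^+ 2)%:E)%E).
have sBle := integral_csc_half_sqr_S3_le (yS i); rewrite -sB in sBle.
have sAle := sA; move/eqP: sAle; rewrite eq_le => /andP[sAle _].
(* [a j] and [b j] are the integrals over cell [j] of the kernel with pole at puncture [i] and of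
   its square. *)
have [j|a [aE a0 as_]] := fin_ge0_sum _ sAle.
  by apply: integral_ge0 => x _; rewrite lee_fin.
have [j|b [bE b0 bs]] := fin_ge0_sum _ sBle.
  by apply: integral_ge0 => x _; rewrite lee_fin sqr_ge0.
rewrite as_ in sA; have {}sA : \sum_j a j = 32 / 3 * pi by apply/EFin_inj.
rewrite bs lee_fin in sBle.
have cstE j (k : R) : (\int[vol]_(x in cell j) k%:E = (k * v j)%:E)%E.
  rewrite integral_cst; last exact: measurable_small_quasi_cube.
  by apply: etrans (congr1 (fun z => k%:E * z)%E (vE1 j)) _; rewrite EFinM.
have yi := @center_preimage_get R n i.
have h1 j : j != i -> v j * K i (y j) <= a j + c * b j.
  rewrite eq_sym => ij.
  have := @le_cell_integral j (cst (K i (y j))) (K i) (fun x => K i x ^+ 2) (measurable_cst _)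
    (mK i) mK2 (fun=> K0 _) K0 (fun=> sqr_ge0 _).
  rewrite cstE aE bE -EFinM -EFinD lee_fin mulrC; apply=> x jx.
  have := csc_half_other_cell n0 ij yi jx (yc j); rewrite ler_norml => /andP[_].
  by rewrite lerBlDr addrC.
have h2 j : j != i -> a j <= v j * K i (y j) + c * b j.
  rewrite eq_sym => ij.
  have := @le_cell_integral j (K i) (cst (K i (y j))) (fun x => K i x ^+ 2)
    (mK i) (measurable_cst _) mK2 K0 (fun=> K0 _) (fun=> sqr_ge0 _).
  rewrite cstE aE bE -EFinM -EFinD lee_fin [K i _ * v j]mulrC; apply=> x jx.
  have := csc_half_other_cell n0 ij yi jx (yc j); rewrite ler_norml => /andP[+ _].
  rewrite /K /= -/c; lra.
(* The sum has no term for cell [i], so its whole integral counts as error. *)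
have h3 : a i <= c * b i.
  have := @le_cell_integral i (K i) (cst 0) (fun x => K i x ^+ 2)
    (mK i) (measurable_cst _) mK2 K0 (fun=> lexx _) (fun=> sqr_ge0 _).
  rewrite cstE aE bE -EFinM -EFinD lee_fin mul0r add0r; apply=> x ix.
  by rewrite add0r; exact: (csc_half_same_cell n0 ix (yc i)).
have cb : c * \sum_j b j <= c * (32 * pi) by rewrite ler_wpM2l.
have bE' : \sum_j b j = b i + \sum_(j | j != i) b j by rewrite (bigD1 i).
have aE' : \sum_j a j = a i + \sum_(j | j != i) a j by rewrite (bigD1 i).
have g1 : S i <= \sum_(j | j != i) a j + c * \sum_(j | j != i) b j.
  by rewrite /S mulr_sumr -big_split/=; apply: ler_sum => j; exact: h1.
have g2 : \sum_(j | j != i) a j <= S i + c * \sum_(j | j != i) b j.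
  by rewrite /S mulr_sumr -big_split/=; apply: ler_sum => j; exact: h2.
have cbi : 0 <= c * b i by rewrite mulr_ge0.
have ai := a0 i.
rewrite bE' mulrDr in cb.
rewrite ler_norml -sA aE'; apply/andP; split; lra.
Qed.

Let St : R := \sum_i v i * S i.

Lemma puncture_double_sum_bound : `|St - V * (32 / 3 * pi)| <= V * (c * (32 * pi)).
Proof.
have [vE1 [v0 vV]] := vE.
rewrite /St -[in X in `|_ - X|]vV -[in leRHS]vV !mulr_suml -sumrB.
apply: (le_trans (ler_norm_sum _ _ _)); apply: ler_sum => i _.
by rewrite -mulrBr normrM ger0_norm// ler_wpM2l// puncture_sum_bound.
Qed.

Lemma total_mass_quasi_cubic (alpha : R) :
  total_mass (quasi_cubic n alpha) = 4 * (alpha / V) ^+ 2 * St.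
Proof.
rewrite /total_mass /quasi_cubic/= /St mulr_sumr; apply: eq_bigr => i _.
rewrite /S !mulr_sumr; apply: eq_bigr => j ji.
rewrite -[_ / sin _]/(_ * (sin _)^-1) sin_half_geodist//; last 2 first.
- exact: yS.
- exact: yS.
by rewrite /K /y /v; ring.
Qed.

(** Every puncture contributes the same integral, so only the total mass enters. The common factor
    appears because 3 pi / 4 * (32 pi / 3)^2 = 4 V * (32 pi / 3). *)
Lemma effective_mass_quasi_cubic (alpha : R) : 0 < alpha ->
  effective_mass (quasi_cubic n alpha) = 4 * (alpha / V) ^+ 2 * (V * (32 / 3 * pi)).
Proof.
move=> al0; have [vE1 [v0 vV]] := vE.
pose m i : R := alpha / V * v i.
have V0 : 0 < V by rewrite mulr_gt0// exprn_gt0.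
have m0 i : 0 <= m i by rewrite mulr_ge0// divr_ge0// ltW.
have K0 i x : 0 <= K i x := csc_half_ge0 _.
suff phi : \int[vol]_(x in S3) conformal_factor (quasi_cubic n alpha) x = alpha * (32 / 3 * pi).
  rewrite /effective_mass /sphere_mean phi.
  by move: (@pi R) pi0 => P P0; field; exact: lt0r_neq0.
rewrite /Rintegral.
transitivity (fine (\int[vol]_(x in S3) (\sum_i (m i * K i x)%:E)))%E.
  congr fine; apply: eq_integral => x; rewrite inE => Sx.
  rewrite sumEFin /conformal_factor/=; congr (_%:E); apply: eq_bigr => i _.
  by rewrite -[_ / sin _]/(_ * (sin _)^-1) sin_half_geodist//; exact: yS.
have mmK i : measurable_fun setT (fun x => m i * K i x : T) by apply: measurable_funM => //; exact: mK.
rewrite (ge0_integral_sum _ measurable_S3); last 2 first.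
- by move=> i; apply: measurable_funTS; apply/measurable_EFinP; exact: mmK.
- by move=> i x _; rewrite lee_fin mulr_ge0.
under eq_bigr => i _.
  under eq_integral do rewrite EFinM.
  rewrite ge0_integralZl; [|exact: measurable_S3| |by move=> x _; rewrite lee_fin|by rewrite lee_fin]; last first.
    by apply: measurable_funTS; apply/measurable_EFinP; exact: mK.
  rewrite integral_csc_half_S3// -EFinM.
  over.
rewrite sumEFin/= -mulr_suml -mulr_sumr vV.
by move: (@pi R) pi0 => P P0; field; exact: lt0r_neq0.
Qed.

(** From n = 204 on the relative error 102 / n is at most 1/2, which keeps the denominator above
    half of its limit. The factor containing [alpha] cancels, so the bound is uniform in it. *)
Lemma relative_deficit_quasi_cubic_bound (alpha : R) : (204 <= n)%N -> 0 < alpha ->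
  0 <= relative_deficit (quasi_cubic n alpha) <= 204 / n%:R.
Proof.
move=> n204 al0; rewrite /relative_deficit total_mass_quasi_cubic effective_mass_quasi_cubic//.
have V0 : 0 < V by rewrite mulr_gt0// exprn_gt0.
set W := V * (32 / 3 * pi); have W0 : 0 < W by rewrite !mulr_gt0// divr_gt0.
set g := 4 * (alpha / V) ^+ 2; have g0 : 0 < g by rewrite mulr_gt0// exprn_gt0// divr_gt0.
have := puncture_double_sum_bound; rewrite -/W.
have -> : V * (c * (32 * pi)) = W * (102 / n%:R) by rewrite /W /c; field; rewrite gt_eqF.
move=> h.
have n2 : 102 / n%:R <= 1 / 2 :> R.
  rewrite ler_pdivrMr//; have : 204%:R <= n%:R :> R by rewrite ler_nat.
  lra.
have Wn : W * (102 / n%:R) <= W * (1 / 2) by rewrite ler_wpM2l// ltW.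
have StW : W / 2 <= St by move: h; rewrite ler_norml => /andP[h1 _]; lra.
have St0 : 0 < St by rewrite (lt_le_trans _ StW)// divr_gt0.
have tm0 : 0 < g * St by exact: mulr_gt0.
rewrite divr_ge0 ?normr_ge0 ?(ltW tm0)//=.
rewrite -mulrBr normrM (gtr0_norm g0) -mulf_div divff ?gt_eqF// mul1r.
rewrite distrC ler_pdivrMr//; apply: (le_trans h).
have -> : W * (102 / n%:R) = 204 / n%:R * (W / 2) by field; rewrite gt_eqF.
by apply: ler_wpM2l => //; rewrite divr_ge0.
Qed.

End Deficit.

Lemma powR_8_cube (R : realType) (n : nat) :
  (8 * n ^ 3)%N%:R `^ (- 3^-1) = (2 * n%:R)^-1 :> R.
Proof.
rewrite (_ : (8 * n ^ 3)%N%:R = (2 * n%:R) `^ 3 :> R).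
  rewrite -powRrM (_ : 3 * - 3^-1 = -1); last by field.
  by rewrite powR_inv1// mulr_ge0.
rewrite -[3 in RHS]/(3%:R) powR_mulrn ?mulr_ge0// natrM natrX exprMn; congr (_ * _).
by rewrite -natrX.
Qed.

Theorem mainTheorem4 (R : realType) :
  (exists C : R, \forall n \near \oo, forall alpha : R, 0 < alpha ->
     relative_deficit (quasi_cubic n alpha)
     <= C * (8 * n ^ 3)%N%:R `^ (- 3^-1)) /\
  (forall alpha : R, 0 < alpha ->
     relative_deficit (quasi_cubic n alpha) @[n --> \oo] --> (0 : R)).
Proof.
split.
  (* 408 / (2n) = 204 / n; the rank 204 is fixed before [alpha]. *)
  exists 408; exists 204%N => // n /= n204 alpha al0.
  have n0 : (0 < n)%N by apply: leq_trans n204.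
  have /andP[_ h] := relative_deficit_quasi_cubic_bound n0 n204 al0.
  apply: (le_trans h); rewrite powR_8_cube invfM mulrA.
  by rewrite (_ : 408 / 2 = 204 :> R)//; lra.
move=> alpha al0; apply/cvgrPdist_le => e e0; near=> n.
have n204 : (204 <= n)%N by near: n; exists 204%N.
have n0 : (0 < n)%N by apply: leq_trans n204.
have /andP[h0 h] := relative_deficit_quasi_cubic_bound n0 n204 al0.
rewrite sub0r normrN ger0_norm//; apply: (le_trans h).
rewrite ler_pdivrMr ?ltr0n// mulrC -ler_pdivrMr//.
by near: n; exact: nbhs_infty_ger.
Unshelve. all: by end_near. Qed.
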